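(* There exist numerical positive constants $c_1,\dots,c_5$ having property (L) stated in the context and for which, in addition, the following holds. Take any $\alpha\in(0,c_3)$, any $n\ge c_1$ and any $\epsilon\in\big(n^{-1/2},(\alpha/2)^{c_2}\big)$. Then for any procedure $R$ with $\mathbf I(R,k_2)\le c_3$ for the sparsity $k_2=\log(1/\epsilon)\,n/\log(n)$, we have $\mathbf{II}(R,k_1,\alpha/2)\ge1/5$ for the sparsity $k_1=\epsilon^{(c_2\log(2/\alpha))^{-1}}\log(1/\epsilon)\,e\,n/\log n$ (where $e=\exp(1)$). In particular, if $n^{-1/4}<(\alpha/2)^{c_2}$, then, with $\delta=1/(4c_2\log(2/\alpha))>0$, for any procedure $R$: - if $\mathbf I(R,n/4)\le\alpha$, then $\mathbf{II}(R,n^{1-\delta}e/4,\alpha/2)\ge1/5$; - if $\mathbf{II}(R,n^{1-\delta}e/4,\alpha/2)<1/5$, then $\mathbf I(R,n/4)>c_3$.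
   Context: Notation: $x\vee y=\max(x,y)$; $\overline\Phi$ is the upper tail function of $\mathcal N(0,1)$; a numerical constant is an absolute constant. Setting. One observes $Y=(Y_1,\dots,Y_n)$ with independent real coordinates, $Y_i\sim P_i$, and $P=\otimes_{i=1}^nP_i$ is the law of $Y$. $\mathcal P$ is the set of all such product distributions $P$ on $\mathbb R^n$ for which there exists $(\theta,\sigma)\in\mathbb R\times(0,\infty)$ with $|\{i: P_i=\mathcal N(\theta,\sigma^2)\}|>n/2$; this couple is unique and denoted $(\theta(P),\sigma(P))$. Let $\mathcal H_0(P)=\{i: P_i=\mathcal N(\theta(P),\sigma(P)^2)\}$ (true nulls), $\mathcal H_1(P)$ the complement of $\mathcal H_0(P)$ in $\{1,\dots,n\}$, $n_1(P)=|\mathcal H_1(P)|$. A multiple testing procedure is a measurable map $R$ from the data $Y$ to subsets $R(Y)\subset\{1,\dots,n\}$ (rejected hypotheses). Set $$\mathrm{FDP}(P,R(Y))=\frac{|R(Y)\cap\mathcal H_0(P)|}{|R(Y)|\vee1},\quad \mathrm{FDR}(P,R)=\mathbb E_{Y\sim P}[\mathrm{FDP}(P,R(Y))],\quad \mathrm{TDP}(P,R(Y))=\frac{|R(Y)\cap\mathcal H_1(P)|}{n_1(P)\vee1}.$$ BH. For $u\in\mathbb R$, $s>0$, let $p_i(u,s)=2\overline\Phi(|Y_i-u|/s)$, $T_\alpha(Y;u,s)=\max\{t\in[0,1]:\sum_{i=1}^n\mathbf 1\{p_i(u,s)\le t\}\ge nt/\alpha\}$ and $\mathrm{BH}_\alpha(Y;u,s)=\{i: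 p_i(u,s)\le T_\alpha(Y;u,s)\}$. The oracle BH procedure is $\mathrm{BH}^*_\alpha=\mathrm{BH}_\alpha(Y;\theta(P),\sigma(P))$. Risks, for real $k>0$: $\mathbf I(R,k)=\sup_{P\in\mathcal P,\,n_1(P)\le k}\mathrm{FDR}(P,R)$ and $\mathbf{II}(R,k,\alpha)=\sup_{P\in\mathcal P,\,n_1(P)\le k}\mathbb P_{Y\sim P}\big(\mathrm{TDP}(P,R)<\mathrm{TDP}(P,\mathrm{BH}^*_\alpha)\big)$. Property (L) of the constants $c_1,\dots,c_5$: for all $n\ge c_1$, any $\alpha\in(0,1)$ and any two positive numbers $k_1\le k_2$ with $c_2\frac{n\log(2/\alpha)}{\log n}[1+\log(k_2/k_1)]\le k_2<n/2$, for any multiple testing procedure $R$ such that $\mathrm{FDR}(P,R)\le c_3$ for any $P\in\mathcal P$ with $n_1(P)\le k_2$, there exists $P\in\mathcal P$ with $n_1(P)\le k_1$ such that $\mathbb P_{Y\sim P}(|R(Y)\cap\mathcal H_1(P)|=0)\ge2/5$ and $\mathbb P_{Y\sim P}\big[|\mathrm{BH}^*_{\alpha/2}\cap\mathcal H_1(P)|\ge c_4\alpha^{-1}\{n/\log n\}^{1/2}\big]\ge1-e^{-c_5\alpha^{-1}\{n/\log n\}^{1/2}}\ge4/5$; in particular $\mathbf I(R,k_2)\le c_3$ implies $\mathbf{II}(R,k_1,\alpha/2)\ge1/5$. *)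

(* Defs.v *)
From HB Require Import structures.
From mathcomp Require Import all_boot all_order all_algebra.
From mathcomp Require Import all_classical all_reals all_analysis.

Set Implicit Arguments.
Unset Strict Implicit.
Unset Printing Implicit Defensive.

Import Order.TTheory GRing.Theory Num.Theory.
Import numFieldNormedType.Exports.

Local Open Scope classical_set_scope.
Local Open Scope ring_scope.

Definition marginal (R : realType) (n : nat) (P : probability (n.-tuple R) R)
    (i : 'I_n) : set R -> \bar R :=
  pushforward P (fun y : n.-tuple R => tnth y i).

(* P is the tensor product of its marginals; evaluating on measurable boxes
   determines P. *)
Definition product_distribution (R : realType) (n : nat)
    (P : probability (n.-tuple R) R) : Prop :=
  forall A : 'I_n -> set R, (forall i, measurable (A i)) ->
    P [set y | forall i, A i (tnth y i)] =
    (\prod_(i < n) marginal P i (A i))%E.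

(* P_i = N(theta, sigma^2). The library's measures are functions defined on all
   subsets of R, with unspecified values outside the sigma-algebra, so two
   distributions are compared on measurable sets only. The second parameter of
   normal_prob is the standard deviation. *)
Definition gaussian_marginal (R : realType) (n : nat)
    (P : probability (n.-tuple R) R) (theta sigma : R) (i : 'I_n) : Prop :=
  forall A : set R, measurable A -> marginal P i A = normal_prob theta sigma A.

Definition gaussian_coordinates (R : realType) (n : nat)
    (P : probability (n.-tuple R) R) (theta sigma : R) : {set 'I_n} :=
  [set i | `[< gaussian_marginal P theta sigma i >]]%SET.

Definition null_parameters (R : realType) (n : nat)
    (P : probability (n.-tuple R) R) : set (R * R) :=
  [set ts | 0 < ts.2 /\
            n%:R / 2 < #|gaussian_coordinates P ts.1 ts.2|%:R :> R].

Definition calP {R : realType} {n : nat} : set (probability (n.-tuple R) R) :=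
  [set P | product_distribution P /\ exists ts, null_parameters P ts].

(* For P in calP, null_parameters P is a singleton: two strict majorities of
   coordinates intersect, and a normal law determines its mean and its standard
   deviation. The default (0, 1) is irrelevant. *)
Definition theta_sigma (R : realType) (n : nat)
    (P : probability (n.-tuple R) R) : R * R :=
  xget (0, 1) (null_parameters P).

Definition theta (R : realType) (n : nat) (P : probability (n.-tuple R) R) : R :=
  (theta_sigma P).1.

Definition sigma (R : realType) (n : nat) (P : probability (n.-tuple R) R) : R :=
  (theta_sigma P).2.

Definition true_nulls (R : realType) (n : nat) (P : probability (n.-tuple R) R) :
    {set 'I_n} :=
  gaussian_coordinates P (theta P) (sigma P).

Definition false_nulls (R : realType) (n : nat) (P : probability (n.-tuple R) R) :
    {set 'I_n} :=
  (~: true_nulls P)%SET.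

Definition n1 (R : realType) (n : nat) (P : probability (n.-tuple R) R) : nat :=
  #|false_nulls P|.

(* Measurability with respect to the discrete sigma-algebra on subsets of
   'I_n. *)
Definition multiple_testing_procedure (R : realType) (n : nat)
    (rej : n.-tuple R -> {set 'I_n}) : Prop :=
  forall B : set {set 'I_n}, measurable (rej @^-1` B).

Definition FDP (R : realType) (n : nat) (P : probability (n.-tuple R) R)
    (A : {set 'I_n}) : R :=
  #|(A :&: true_nulls P)%SET|%:R / (maxn #|A| 1)%:R.

Definition TDP (R : realType) (n : nat) (P : probability (n.-tuple R) R)
    (A : {set 'I_n}) : R :=
  #|(A :&: false_nulls P)%SET|%:R / (maxn (n1 P) 1)%:R.

Definition FDR (R : realType) (n : nat) (P : probability (n.-tuple R) R)
    (rej : n.-tuple R -> {set 'I_n}) : \bar R :=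
  ('E_P[fun y => FDP P (rej y)])%E.

Definition upper_tail (R : realType) (x : R) : R :=
  fine (normal_prob 0 1 `]x, +oo[).

Definition pvalue (R : realType) (n : nat) (y : n.-tuple R) (u s : R)
    (i : 'I_n) : R :=
  2 * upper_tail (`|tnth y i - u| / s).

Definition BH_set (R : realType) (n : nat) (alpha : R) (y : n.-tuple R)
    (u s : R) : set R :=
  [set t | 0 <= t <= 1 /\
           n%:R * t / alpha <= #|[set i | pvalue y u s i <= t]%SET|%:R].

(* The supremum is a maximum, see BH_threshold_max. *)
Definition BH_threshold (R : realType) (n : nat) (alpha : R) (y : n.-tuple R)
    (u s : R) : R :=
  sup (BH_set alpha y u s).

Lemma BH_threshold_max (R : realType) (n : nat) (alpha : R) (y : n.-tuple R)
    (u s : R) :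
  0 < alpha ->
  BH_set alpha y u s (BH_threshold alpha y u s) /\
  (forall t, BH_set alpha y u s t -> t <= BH_threshold alpha y u s).
Proof.
move=> a0; set E := BH_set alpha y u s; rewrite /BH_threshold -/E.
have E0 : E 0 by split; rewrite ?lexx ?ler01// mulr0 mul0r.
have ubE : has_ubound E by exists 1 => t [/andP[]].
have hsE : has_sup E by split => //; exists 0.
have le_sup t : E t -> t <= sup E by move=> Et; exact: ub_le_sup.
split; last exact: le_sup.
split; first by rewrite le_sup//= ge_sup//; [exists 0 | move=> t [/andP[]]].
set m := sup E; set N := (X in _ <= X); rewrite leNgt; apply/negP => ltN.
have n0 : 0 < n%:R :> R.
  rewrite ltr0n lt0n; apply/eqP => n0; move: ltN.
  by rewrite {1}n0 !mul0r ltNge ler0n.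
have : alpha * N / n%:R < m.
  by move: ltN; rewrite ltr_pdivlMr// ltr_pdivrMr// mulrC [m * _]mulrC.
move=> /sup_gt[|t Et]; first by exists 0.
rewrite ltr_pdivrMr// => ltt; have [_] := Et.
rewrite leNgt => /negP; apply; rewrite ltr_pdivlMr//.
rewrite [n%:R * t]mulrC; apply: le_lt_trans ltt.
rewrite mulrC ler_pM2l// ler_nat; apply/subset_leq_card/fintype.subsetP => j.
by rewrite !inE => /le_trans; apply; exact: le_sup.
Qed.

Definition BH (R : realType) (n : nat) (alpha : R) (y : n.-tuple R) (u s : R) :
    {set 'I_n} :=
  [set i | pvalue y u s i <= BH_threshold alpha y u s]%SET.

Definition oracle_BH (R : realType) (n : nat) (P : probability (n.-tuple R) R)
    (alpha : R) (y : n.-tuple R) : {set 'I_n} :=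
  BH alpha y (theta P) (sigma P).

Definition sparse_model (R : realType) (n : nat) (k : R) :
    set (probability (n.-tuple R) R) :=
  [set P | calP P /\ (n1 P)%:R <= k].

Definition risk_I (R : realType) (n : nat) (rej : n.-tuple R -> {set 'I_n})
    (k : R) : \bar R :=
  ereal_sup [set FDR P rej | P in sparse_model k].

Definition risk_II (R : realType) (n : nat) (rej : n.-tuple R -> {set 'I_n})
    (k alpha : R) : \bar R :=
  ereal_sup
    [set P [set y | TDP P (rej y) < TDP P (oracle_BH P alpha y)]
    | P in sparse_model k].

Definition property_L (R : realType) (c1 c2 c3 c4 c5 : R) : Prop :=
  forall n : nat, c1 <= n%:R ->
  forall alpha : R, 0 < alpha -> alpha < 1 ->
  forall k1 k2 : R, 0 < k1 -> k1 <= k2 ->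
  c2 * (n%:R * ln (2 / alpha) / ln n%:R) * (1 + ln (k2 / k1)) <= k2 ->
  k2 < n%:R / 2 ->
  forall rej : n.-tuple R -> {set 'I_n}, multiple_testing_procedure rej ->
  let r := alpha^-1 * Num.sqrt (n%:R / ln n%:R) in
  ((forall P, calP P -> (n1 P)%:R <= k2 -> (FDR P rej <= c3%:E)%E) ->
   exists P : probability (n.-tuple R) R,
     [/\ calP P /\ (n1 P)%:R <= k1,
         (P [set y | #|(rej y :&: false_nulls P)%SET| = 0%N] >= (2 / 5)%:E)%E,
         (P [set y | (#|(oracle_BH P (alpha / 2) y :&: false_nulls P)%SET|%:R >= c4 * r)%R]
            >= (1 - expR (- (c5 * r)))%:E)%E &
         1 - expR (- (c5 * r)) >= 4 / 5])
  /\ ((risk_I rej k2 <= c3%:E)%E -> (risk_II rej k1 (alpha / 2) >= (1 / 5)%:E)%E).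

(* Main.v *)
Require Import Defs.
From HB Require Import structures.
From mathcomp Require Import all_boot all_order all_algebra.
From mathcomp Require Import all_classical all_reals all_analysis.
From mathcomp Require Import measurable_realfun.
From mathcomp Require Import ring lra zify.

(** The oracle knows which Gaussian law is the null; the lower bound exhibits
two Gaussian readings of one and the same sample between which no procedure
can choose.

Let [f] be the standard normal density and [g] the density of [N(0, s^2)],
[s > 1]. For a weight [rho < 1] close to [1], put [m = max f (rho g)] and
[D = \int m - 1]. The density [m / (1 + D)] is a mixture of [f] with a law [g1]
carried by the tail region [U = {f < rho g}], and also a mixture of [g] with a
law [g2] carried by the complement of [U] ([exists_two_readings]). In the
first reading the null is [N(0, 1)] and a small proportion
[p = D / (1 + D)] of the sample is drawn from [g1]; in the second one the null
is [N(0, s^2)] and a proportion [q] is drawn from [g2]. Conditioning on which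
coordinates are contaminated turns an i.i.d. sample of the mixture into an
average of product laws, which belong to the model unless too many coordinates
are contaminated, an unlikely case; [eq_mixture] says that both averages agree
on every event.

A procedure whose false discovery rate is small for both readings rejects
almost nothing. If it rejects something, at least half of its rejections lie
in [U] or at least half lie outside [U]. Outside [U] every observation is a
true null of the first reading, and inside [U] every observation is a true null
of the second one, so in either case the false discovery proportion is at least
one half in one of the readings ([FDR_majority_bound]); Markov's inequality
concludes. Hence some configuration of the first reading,
with at least a quarter of the expected number of contaminated coordinates and
at most [k1] of them, leaves the procedure without rejections with
probability at least [2 / 5] ([exists_undetected]).

On that configuration the oracle is powerful. With [1 / s^2 = 1 - b] and [rho]
chosen so that [rho g / f = exp (b (x^2 - t2) / 2)], the contamination [p g1]
has, beyond [sqrt (ln n)], at least [(exp (b (ln n - t2) / 2) - 1) / 2] times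
the mass of the standard normal law. The assumption linking [k1], [k2] and
[alpha] allows [b ln n >= 20 ln (2 / alpha)] while the contaminations stay below [k1] and
[k2] ([exists_tilt_parameters]); the excess of observations
beyond [sqrt (ln n)] then exceeds what Benjamini-Hochberg requires at level
[alpha / 2], and a Chernoff bound ([oracle_power]) shows that about
[sqrt (n / ln n) / alpha] true discoveries occur. This is
[exists_hard_distribution], hence property (L).

The remaining part is a computation: for [k1] and [k2] expressed through
[eps], the condition in property (L) becomes an equality
([sparsity_trade_off]), and [eps = n^(-1/4)] gives [k2 = n / 4] and
[k1 = n^(1 - delta) e / 4]. *)

Import Order.TTheory GRing.Theory Num.Theory.
Import numFieldNormedType.Exports.

Local Open Scope classical_set_scope.
Local Open Scope ring_scope.

Set Implicit Arguments.
Unset Strict Implicit.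
Unset Printing Implicit Defensive.

Local Notation leb := lebesgue_measure.

(** * Product measures on tuples *)

Definition box {R : realType} {n : nat} (A : 'I_n -> set R) : set (n.-tuple R) :=
  [set y | forall i, A i (tnth y i)].

Lemma boxE (R : realType) (n : nat) (A : 'I_n -> set R) :
  box A = \bigcap_(i in [set: 'I_n]) ((fun y : n.-tuple R => tnth y i) @^-1` A i).
Proof. apply/seteqP; split => y yA i; [move=> _; exact: yA | exact: (yA i I)]. Qed.

Lemma measurable_tnth_preimage (R : realType) (n : nat) (i : 'I_n) (A : set R) :
  measurable A -> measurable [set y : n.-tuple R | A (tnth y i)].
Proof.
by move=> mA; rewrite -[X in measurable X]setTI; exact: measurable_tnth.
Qed.

Lemma measurable_box (R : realType) (n : nat) (A : 'I_n -> set R) :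
  (forall i, measurable (A i)) -> measurable (box A).
Proof.
move=> mA; rewrite boxE; apply: fin_bigcap_measurable => // i _.
exact: measurable_tnth_preimage.
Qed.

(** Induction on the length: prepend a coordinate, independent of the tuple
already built. Everything below uses only the mass of boxes, never this
construction. *)
Lemma exists_product_measure (R : realType) (n : nat)
    (mu : 'I_n -> probability R R) :
  exists P : probability (n.-tuple R) R, forall A : 'I_n -> set R,
    (forall i, measurable (A i)) ->
    P (box A) = (\prod_(i < n) mu i (A i))%E.
Proof.
elim: n mu => [|n IH] mu.
  exists (dirac [tuple]) => A mA; rewrite big_ord0 /= diracE mem_set// => i.
  by case: i.
have [P PE] := IH (fun i => mu (lift ord0 i)).
pose f := fun x : R * n.-tuple R => [the n.+1.-tuple R of x.1 :: x.2].
have mf : measurable_fun setT f by apply: measurable_cons.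
pose F : {mfun (R * n.-tuple R)%type >-> n.+1.-tuple R} :=
  HB.pack f (isMeasurableFun.Build _ _ _ _ _ mf).
exists (distribution (mu ord0 \x P)%E F) => A mA.
rewrite /distribution /pushforward /= big_ord_recl -PE//.
have -> : F @^-1` box A = A ord0 `*` box (fun i => A (lift ord0 i)).
  apply/seteqP; split => -[x y]/=.
    move=> h; split; first by have := h ord0.
    by move=> i /=; have := h (lift ord0 i); rewrite tnthS.
  move=> [Ax Ay] i; case: (unliftP ord0 i) => [j|] ->; last exact: Ax.
  by rewrite tnthS; exact: Ay.
by rewrite product_measure1E//; exact: measurable_box.
Qed.

(** Boxes form a pi-system that generates the sigma-algebra of tuples. *)
Lemma eq_measure_box (R : realType) (n : nat)
    (m1 m2 : {measure set (n.-tuple R) -> \bar R}) :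
  (m1 setT < +oo)%E ->
  (forall A : 'I_n -> set R, (forall i, measurable (A i)) ->
     m1 (box A) = m2 (box A)) ->
  forall S, measurable S -> m1 S = m2 S.
Proof.
move=> fin1 m12 S mS.
pose G := [set S : set (n.-tuple R) |
  exists2 A : 'I_n -> set R, (forall i, measurable (A i)) & S = box A].
have boxT : box (fun=> setT) = [set: n.-tuple R] by apply/seteqP; split.
apply: (measure_unique G (fun=> setT)) => //.
- apply/seteqP; split => [B|B].
    apply: smallest_sub => //.
    rewrite -bigcup_seq => C [i _ [X mX <-]]; apply: sub_sigma_algebra.
    exists (fun j => if j == i then X else setT) => [j|]; first by case: ifP.
    rewrite setTI; apply/seteqP; split => y /=; last by move/(_ i); rewrite eqxx.
    by move=> Xy j; have [->|] := eqVneq j i.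
  apply: smallest_sub; first exact: sigma_algebra_measurable.
  by move=> _ [A mA ->]; exact: measurable_box.
- move=> _ _ [A mA ->] [B mB ->]; exists (fun i => A i `&` B i) => [i|].
    exact: measurableI.
  apply/seteqP; split => y; first by case=> Ay By i; split; [exact: Ay|exact: By].
  by move=> ABy; split => i; case: (ABy i).
- by move=> _; exists (fun=> setT).
- by apply/seteqP; split => // y _; exists 0%N.
- by move=> _ [A mA ->]; exact: m12.
Qed.

(** Averages of laws over the contaminated coordinates are packaged as a single
measure in order to use uniqueness on boxes and subadditivity. *)
Lemma exists_combination (d : measure_display) (T : measurableType d)
    (R : realType) (I : finType) (w : I -> R) (P : I -> probability T R) :
  (forall i, 0 <= w i) ->
  exists M : {measure set T -> \bar R}, forall S,
    M S = (\sum_i (w i)%:E * P i S)%E.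
Proof.
move=> w0; case: (pickP (@predT I)) => [i0 _|I0]; last first.
  by exists mzero => S; rewrite big1// => i; have := I0 i.
pose m k := mscale (NngNum (w0 (nth i0 (enum I) k))) (P (nth i0 (enum I) k)).
exists (msum m #|I|) => S.
by rewrite /msum -big_enum/= (big_nth i0) -cardE big_mkord.
Qed.

Definition product_measure {R : realType} {n : nat}
    (mu : 'I_n -> probability R R) : probability (n.-tuple R) R :=
  projT1 (cid (exists_product_measure mu)).

Lemma product_measureE (R : realType) (n : nat) (mu : 'I_n -> probability R R)
    (A : 'I_n -> set R) : (forall i, measurable (A i)) ->
  product_measure mu (box A) = (\prod_(i < n) mu i (A i))%E.
Proof. by rewrite /product_measure; case: cid => P /= + mA; exact. Qed.

Lemma fine_probability_itv (d : measure_display) (T : measurableType d)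
    (R : realType) (P : probability T R) (A : set T) :
  measurable A -> 0 <= fine (P A) <= 1.
Proof.
move=> mA; rewrite fine_ge0//= -lee_fin fineK ?fin_num_measure//.
exact: probability_le1.
Qed.

Lemma product_measure_fine (R : realType) (n : nat)
    (mu : 'I_n -> probability R R) (A : 'I_n -> set R) :
  (forall i, measurable (A i)) ->
  product_measure mu (box A) = (\prod_(i < n) fine (mu i (A i)))%:E.
Proof.
move=> mA; rewrite product_measureE// -prodEFin; apply: eq_bigr => i _.
by rewrite fineK// fin_num_measure.
Qed.

Lemma marginal_product_measure (R : realType) (n : nat)
    (mu : 'I_n -> probability R R) (i : 'I_n) (A : set R) :
  measurable A -> marginal (product_measure mu) i A = mu i A.
Proof.
move=> mA; pose B j := if j == i then A else setT.
have mB j : measurable (B j) by rewrite /B; case: ifP.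
have -> : marginal (product_measure mu) i A = product_measure mu (box B).
  congr (product_measure mu _); apply/seteqP; split => y /=.
    by rewrite /B => Ay j; case: ifP => // /eqP ->.
  by move/(_ i); rewrite /B eqxx.
rewrite product_measureE// (bigD1 i)//= {1}/B eqxx big1 ?mule1// => j /negbTE ji.
by rewrite /B ji probability_setT.
Qed.

Lemma product_measure_product_distribution (R : realType) (n : nat)
    (mu : 'I_n -> probability R R) : product_distribution (product_measure mu).
Proof.
move=> A mA; rewrite [LHS](product_measureE mu mA); apply: eq_bigr => i _.
by rewrite marginal_product_measure.
Qed.

(** * Binomial tails *)

(** The probability of the outcome [Z] of independent coin flips, the [i]-th of
which succeeds with probability [p i]. *)
Definition bit_weight {R : realType} {n : nat} (p : 'I_n -> R)
    (Z : {ffun 'I_n -> bool}) : R :=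
  \prod_i (if Z i then p i else 1 - p i).

Definition ones {n : nat} (Z : {ffun 'I_n -> bool}) : nat := #|[set i | Z i]%SET|.

Lemma sum_prod_bit (R : realType) (n : nat) (F : 'I_n -> bool -> R) :
  \sum_(Z : {ffun 'I_n -> bool}) \prod_i F i (Z i) =
  \prod_i (F i true + F i false).
Proof.
rewrite -(bigA_distr_bigA F); apply: eq_bigr => i _.
by rewrite big_bool.
Qed.

Lemma bit_weight_ge0 (R : realType) (n : nat) (p : 'I_n -> R)
    (Z : {ffun 'I_n -> bool}) :
  (forall i, 0 <= p i <= 1) -> 0 <= bit_weight p Z.
Proof.
move=> p01; apply: prodr_ge0 => i _; have /andP[p0 p1] := p01 i.
by case: ifP; rewrite ?subr_ge0.
Qed.

Lemma sum_bit_weight (R : realType) (n : nat) (p : 'I_n -> R) :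
  \sum_Z bit_weight p Z = 1.
Proof.
rewrite (sum_prod_bit (fun i b => if b then p i else 1 - p i)) big1// => i _.
by rewrite addrC subrK.
Qed.

Lemma onesE (R : realType) (n : nat) (Z : {ffun 'I_n -> bool}) :
  (ones Z)%:R = \sum_i (Z i)%:R :> R.
Proof.
rewrite /ones -sum1_card natr_sum big_mkcond/=; apply: eq_bigr => i _.
by rewrite inE; case: (Z i).
Qed.

Lemma expRN1_le_half (R : realType) : expR (- 1) <= 1 / 2 :> R.
Proof.
rewrite expRN mul1r lef_pV2 ?posrE ?expR_gt0//.
by have := @expR_ge1Dx R 1.
Qed.

(** Chernoff's bound with exponential parameter [1]:
[E exp (- ones) = \prod (1 - p i (1 - 1/e))], and [1 - 1/e >= 1/2]. *)
Lemma bit_weight_lower_tail (R : realType) (n : nat) (p : 'I_n -> R) (s : R) :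
  (forall i, 0 <= p i <= 1) ->
  \sum_(Z | (ones Z)%:R < s) bit_weight p Z <= expR (s - (\sum_i p i) / 2).
Proof.
move=> p01.
apply: (@le_trans _ _ (\sum_Z bit_weight p Z * expR (s - (ones Z)%:R))).
  rewrite big_mkcond/=; apply: ler_sum => Z _; case: ifPn => [lts|_].
    by rewrite ler_peMr ?bit_weight_ge0// -[leLHS]expR0 ler_expR subr_ge0 ltW.
  by rewrite mulr_ge0 ?bit_weight_ge0 ?expR_ge0.
have E Z : bit_weight p Z * expR (s - (ones Z)%:R) =
    expR s * \prod_i (if Z i then p i * expR (- 1) else 1 - p i).
  rewrite expRD mulrCA; congr (_ * _); rewrite onesE -sumrN expR_sum -big_split/=.
  by apply: eq_bigr => i _; case: (Z i); rewrite ?oppr0 ?expR0 ?mulr1.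
under eq_bigr do rewrite E.
rewrite -mulr_sumr expRD ler_wpM2l ?expR_ge0//.
rewrite (sum_prod_bit (fun i b => if b then p i * expR (- 1) else 1 - p i)).
rewrite mulr_suml -sumrN expR_sum; apply: ler_prod => i _.
have /andP[p0 p1] := p01 i; apply/andP; split.
  by rewrite addr_ge0 ?subr_ge0// mulr_ge0 ?expR_ge0.
apply: le_trans (expR_ge1Dx _).
rewrite /=; have : p i * expR (- 1) <= p i * (1 / 2) by rewrite ler_wpM2l// expRN1_le_half.
lra.
Qed.

(** Markov's inequality is enough here, as the expected number of contaminated
coordinates can be kept below a small fraction of the sparsity bound. *)
Lemma bit_weight_upper_tail (R : realType) (n : nat) (p : 'I_n -> R) (k : R) :
  (forall i, 0 <= p i <= 1) -> 0 < k ->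
  \sum_(Z | k < (ones Z)%:R) bit_weight p Z <= (\sum_i p i) / k.
Proof.
move=> p01 k0; rewrite ler_pdivlMr//.
apply: (@le_trans _ _ (\sum_Z bit_weight p Z * (ones Z)%:R)).
  rewrite mulr_suml big_mkcond/=; apply: ler_sum => Z _; case: ifPn => [lts|_].
    by rewrite ler_wpM2l ?bit_weight_ge0 ?ltW.
  by rewrite mulr_ge0 ?bit_weight_ge0.
under eq_bigr do rewrite onesE mulr_sumr.
rewrite exchange_big/=; apply: ler_sum => i _.
pose F j b : R := (if b then p j else 1 - p j) * (if j == i then b%:R else 1).
rewrite (eq_bigr (fun Z : {ffun 'I_n -> bool} => \prod_j F j (Z j))); last first.
  move=> Z _; rewrite /F big_split/=; congr (_ * _).
  by rewrite -big_mkcond/= big_pred1_eq.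
rewrite sum_prod_bit (bigD1 i)//= big1 => [|j /negbTE ji].
  by rewrite /F eqxx mulr1 mulr0 addr0 mulr1.
by rewrite /F ji !mulr1 addrC subrK.
Qed.

Lemma le_measure_bigsetU (d : measure_display) (T : measurableType d)
    (R : realType) (P : probability T R) (I : finType) (A : I -> set T)
    (D : pred I) (B : set T) :
  measurable B -> (forall i, measurable (A i)) ->
  (forall x, B x -> exists2 i, D i & A i x) ->
  (P B <= \sum_(i | D i) P (A i))%E.
Proof.
move=> mB mA sub; apply: (@le_trans _ _ (P (\big[setU/set0]_(i | D i) A i))).
  apply: le_measure; rewrite ?inE//; first exact: bigsetU_measurable.
  by move=> x /sub[i Di Aix]; rewrite -bigcup_seq_cond; exists i => //=; rewrite mem_index_enum.
suff [] : measurable (\big[setU/set0]_(i | D i) A i) /\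
  (P (\big[setU/set0]_(i | D i) A i) <= \sum_(i | D i) P (A i))%E by [].
elim/big_rec2: _ => [|i y U Di [mU le_y]]; first by rewrite measure0; split.
split; first exact: measurableU.
by apply: le_trans (measureU2 _ (mA i) mU) _; rewrite leeD2l.
Qed.

(** The hits [y_i \in A i] are independent coin flips, so that finite
combinatorics controls their number. *)
Lemma product_measure_count (R : realType) (n : nat)
    (mu : 'I_n -> probability R R) (A : 'I_n -> set R) (s : R) :
  (forall i, measurable (A i)) ->
  measurable [set y : n.-tuple R | #|[set i | `[< A i (tnth y i) >]]%SET|%:R < s]
  /\ (product_measure mu
        [set y | (#|[set i | `[< A i (tnth y i) >]]%SET|%:R < s)%R] <=
      (\sum_(Z | ((ones Z)%:R < s)%R) bit_weight (fun i => fine (mu i (A i))) Z)%:E)%E.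
Proof.
move=> mA.
pose B (Z : {ffun 'I_n -> bool}) i := if Z i then A i else ~` A i.
have mB Z i : measurable (B Z i).
  by rewrite /B; case: ifP => // _; exact: measurableC.
set C := (X in measurable X).
have CE : C = \big[setU/set0]_(Z : {ffun 'I_n -> bool} | (ones Z)%:R < s) box (B Z).
  rewrite -bigcup_seq_cond; apply/seteqP; split => y /=.
    move=> ys; exists [ffun i => `[< A i (tnth y i) >]] => /=.
      rewrite mem_index_enum/= /ones (_ : [set i | _]%SET = [set i | `[< A i (tnth y i) >]]%SET)//.
      by apply/setP => i; rewrite !inE ffunE.
    by move=> i; rewrite /B ffunE; case: asboolP.
  move=> [Z /=]; rewrite mem_index_enum/= => Zs By.
  rewrite /C/= (_ : [set i | _]%SET = [set i | Z i]%SET)//.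
  apply/setP => i; rewrite !inE; have := By i; rewrite /B.
  by case: (Z i) => Ai; apply/asboolP.
have mC : measurable C.
  by rewrite CE; apply: bigsetU_measurable => Z _; exact: measurable_box.
split => //; rewrite -sumEFin.
apply: le_trans (@le_measure_bigsetU _ _ _ _ _ (fun Z => box (B Z)) (fun Z => (ones Z)%:R < s) _ mC _ _) _.
- by move=> Z; exact: measurable_box.
- by rewrite CE => y; rewrite -bigcup_seq_cond => -[Z /= /andP[_ Zs] By]; exists Z.
apply: lee_sum => Z _; rewrite product_measure_fine// lee_fin.
rewrite le_eqVlt; apply/orP; left; apply/eqP; apply: eq_bigr => i _.
rewrite /B; case: (Z i) => //; rewrite probability_setC//.
by rewrite fineB// fin_num_measure.
Qed.

(** * Mixtures of contaminated samples *)

Definition contaminated {R : realType} {n : nat} (g0 g1 : probability R R)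
    (Z : {ffun 'I_n -> bool}) : probability (n.-tuple R) R :=
  product_measure (fun i => if Z i then g1 else g0).

(** Both sides are the law of an i.i.d. sample of the common marginal mixture:
on a box, expanding the product of the mixed masses gives the sum over all
configurations of contaminated coordinates. *)
Lemma eq_mixture (R : realType) (n : nat) (g0 g1 h0 h1 : probability R R)
    (p q : R) : 0 <= p <= 1 -> 0 <= q <= 1 ->
  (forall A, measurable A ->
     ((1 - p)%:E * g0 A + p%:E * g1 A = (1 - q)%:E * h0 A + q%:E * h1 A)%E) ->
  forall S : set (n.-tuple R), measurable S ->
  (\sum_Z (bit_weight (fun=> p) Z)%:E * contaminated g0 g1 Z S =
   \sum_Z (bit_weight (fun=> q) Z)%:E * contaminated h0 h1 Z S)%E.
Proof.
move=> p01 q01 gh S mS.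
have [M ME] := @exists_combination _ _ _ _ _ (@contaminated R n g0 g1)
  (fun Z => @bit_weight_ge0 _ _ (fun=> p) Z (fun=> p01)).
have [N NE] := @exists_combination _ _ _ _ _ (@contaminated R n h0 h1)
  (fun Z => @bit_weight_ge0 _ _ (fun=> q) Z (fun=> q01)).
rewrite -ME -NE.
have mixE (a0 a1 : probability R R) r (A : 'I_n -> set R) : (forall i, measurable (A i)) ->
    (\sum_Z (bit_weight (fun=> r) Z)%:E * contaminated a0 a1 Z (box A) =
     (\prod_i (r * fine (a1 (A i)) + (1 - r) * fine (a0 (A i))))%:E)%E.
  move=> mA; rewrite -(sum_prod_bit (fun i b =>
    (if b then r else 1 - r) * fine ((if b then a1 else a0) (A i)))) -sumEFin.
  apply: eq_bigr => Z _; rewrite product_measure_fine// -EFinM /bit_weight.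
  by rewrite -big_split.
apply: eq_measure_box => //.
  rewrite ME; have -> : [set: n.-tuple R] = box (fun=> setT).
    by apply/seteqP; split.
  by rewrite mixE// ltry.
move=> A mA; rewrite ME NE !mixE//; congr (_%:E); apply: eq_bigr => i _.
have := gh _ (mA i).
have fE (a : probability R R) : a (A i) = (fine (a (A i)))%:E.
  by rewrite fineK// fin_num_measure.
rewrite (fE g0) (fE g1) (fE h0) (fE h1) -!EFinM -!EFinD => -[e].
by rewrite addrC e addrC.
Qed.

(** * Measurability of rejection sets *)

Lemma upper_tail_nonincreasing (R : realType) (x y : R) :
  x <= y -> upper_tail y <= upper_tail x.
Proof.
move=> xy; rewrite /upper_tail fine_le ?fin_num_measure//.
by rewrite le_measure ?inE//; apply: subset_itvr; rewrite bnd_simp.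
Qed.

Lemma measurable_pvalue_le (R : realType) (n : nat) (u s c : R) (i : 'I_n) :
  measurable [set y : n.-tuple R | pvalue y u s i <= c].
Proof.
pose J := [set z : R | 2 * upper_tail z <= c].
have mJ : measurable J.
  apply: is_interval_measurable => a b Ja _ z /andP[az _].
  rewrite /J/=; apply: le_trans Ja.
  by rewrite ler_pM2l// upper_tail_nonincreasing.
have mf : measurable_fun setT (fun y : n.-tuple R => `|tnth y i - u| / s).
  apply: measurable_funM => //.
  apply: (@measurableT_comp _ _ _ _ _ _ (@Num.norm R R)); first exact: normr_measurable.
  by apply: measurable_funB => //; exact: measurable_tnth.
by rewrite -[X in measurable X]setTI; exact: (mf measurableT J mJ).
Qed.

(** The supremum defining the threshold is a condition on uncountably many
levels. The number of p-values below a level takes at most [n + 1] values, so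
only the levels [min 1 (alpha k / n)] matter; this is what makes the procedure
measurable. *)
Lemma mem_BH (R : realType) (n : nat) (alpha : R) (y : n.-tuple R) (u s : R)
    (i : 'I_n) : 0 < alpha ->
  i \in BH alpha y u s <->
  exists2 k : 'I_n.+1, pvalue y u s i <= Num.min 1 (alpha * k%:R / n%:R) &
    (k <= #|[set j | (pvalue y u s j <= Num.min 1 (alpha * k%:R / n%:R))%R]%SET|)%N.
Proof.
move=> a0; have n0 : 0 < n%:R :> R by rewrite ltr0n; case: n y i => [|//] y [].
have [[/andP[T0 T1] TE] Tmax] := BH_threshold_max y u s a0.
rewrite inE; split => [piT|[k pik kle]].
  pose N := #|[set j | pvalue y u s j <= BH_threshold alpha y u s]%SET|.
  have Nn : (N < n.+1)%N by rewrite ltnS (leq_trans (max_card _))// card_ord.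
  have TN : BH_threshold alpha y u s <= Num.min 1 (alpha * N%:R / n%:R).
    rewrite le_min T1/= ler_pdivlMr// mulrC [leRHS]mulrC.
    by rewrite -ler_pdivrMr.
  exists (Ordinal Nn); first exact: le_trans piT _.
  apply/subset_leq_card/fintype.subsetP => j; rewrite !inE => /le_trans; exact.
apply: (le_trans pik); apply: Tmax; split.
  apply/andP; split; last by rewrite ge_min lexx.
  by rewrite le_min ler01/= !mulr_ge0 ?invr_ge0 ?(ltW a0) ?(ltW n0).
apply: (@le_trans _ _ k%:R); last by rewrite ler_nat.
rewrite ler_pdivrMr// mulrC -ler_pdivlMr// [k%:R * _]mulrC.
by rewrite ge_min lexx orbT.
Qed.

Lemma measurable_mem_BH (R : realType) (n : nat) (alpha u s : R) (i : 'I_n) :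
  0 < alpha -> measurable [set y : n.-tuple R | i \in BH alpha y u s].
Proof.
move=> a0; pose c (k : 'I_n.+1) : R := Num.min 1 (alpha * k%:R / n%:R).
have -> : [set y : n.-tuple R | i \in BH alpha y u s] =
    \big[setU/set0]_(k : 'I_n.+1) \big[setU/set0]_(S : {set 'I_n} | (k <= #|S|)%N)
      ([set y | pvalue y u s i <= c k] `&`
       \big[setI/setT]_(j in S) [set y | pvalue y u s j <= c k]).
  apply/seteqP; split => y /=.
    move=> /(mem_BH _ _ _ _ a0)[k pk kle]; rewrite -bigcup_seq.
    exists k; first by rewrite /= mem_index_enum.
    rewrite -bigcup_seq_cond; exists [set j | pvalue y u s j <= c k]%SET.
      by rewrite /= mem_index_enum.
    split => //; rewrite -bigcap_seq_cond => j /= /andP[_].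
    by rewrite inE.
  rewrite -bigcup_seq => -[k _]; rewrite -bigcup_seq_cond => -[S /= /andP[_ kS]] [pk].
  rewrite -bigcap_seq_cond => Sk; apply/(mem_BH _ _ _ _ a0); exists k => //.
  apply: (leq_trans kS); apply/subset_leq_card/fintype.subsetP => j jS.
  by rewrite inE; apply: Sk; rewrite /= mem_index_enum.
apply: bigsetU_measurable => k _; apply: bigsetU_measurable => S _.
apply: measurableI; first exact: measurable_pvalue_le.
by apply: bigsetI_measurable => j _; exact: measurable_pvalue_le.
Qed.

Lemma multiple_testing_procedure_mem (R : realType) (n : nat)
    (rej : n.-tuple R -> {set 'I_n}) :
  (forall i, measurable [set y | i \in rej y]) -> multiple_testing_procedure rej.
Proof.
move=> mrej B.
have -> : rej @^-1` B = \big[setU/set0]_(S : {set 'I_n} | `[< B S >])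
    \big[setI/setT]_(i : 'I_n)
      (if i \in S then [set y | i \in rej y] else ~` [set y | i \in rej y]).
  apply/seteqP; split => y /=.
    move=> By; rewrite -bigcup_seq_cond; exists (rej y).
      by rewrite /= mem_index_enum; apply/asboolP.
    rewrite -bigcap_seq => i /= _; case: ifPn => //= h; exact/negP.
  rewrite -bigcup_seq_cond => -[S /= /andP[_ /asboolP BS]].
  rewrite -bigcap_seq => yS; rewrite (_ : rej y = S)//.
  apply/setP => i; have := yS i; rewrite /= mem_index_enum => /(_ isT).
  by case: ifPn => //= _ /negP/negbTE.
apply: bigsetU_measurable => S _; apply: bigsetI_measurable => i _.
by case: ifP => _; [|apply: measurableC]; exact: mrej.
Qed.

Lemma multiple_testing_procedure_BH (R : realType) (n : nat) (alpha u s : R) :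
  0 < alpha ->
  multiple_testing_procedure (fun y : n.-tuple R => BH alpha y u s).
Proof.
by move=> a0; apply: multiple_testing_procedure_mem => i; exact: measurable_mem_BH.
Qed.

Lemma measurable_hits (R : realType) (n : nat) (U : set R) (Q : set {set 'I_n}) :
  measurable U ->
  measurable [set y : n.-tuple R | Q [set i | `[< U (tnth y i) >]]%SET].
Proof.
move=> mU.
suff : multiple_testing_procedure
  (fun y : n.-tuple R => [set i | `[< U (tnth y i) >]]%SET) by apply.
apply: multiple_testing_procedure_mem => i.
rewrite (_ : mkset _ = [set y : n.-tuple R | U (tnth y i)]).
  exact: measurable_tnth_preimage.
by apply/seteqP; split => y /=; rewrite inE => /asboolP.
Qed.

(** Condition on the value of the procedure, which ranges over a finite type. *)
Lemma measurable_rejections (R : realType) (n : nat)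
    (rej : n.-tuple R -> {set 'I_n}) (E : {set 'I_n} -> set (n.-tuple R)) :
  multiple_testing_procedure rej -> (forall S, measurable (E S)) ->
  measurable [set y | E (rej y) y].
Proof.
move=> mrej mE.
have -> : [set y | E (rej y) y] =
    \big[setU/set0]_(S : {set 'I_n}) (rej @^-1` [set S] `&` E S).
  apply/seteqP; split => y /=.
    by move=> Ey; rewrite -bigcup_seq; exists (rej y) => //=; rewrite mem_index_enum.
  by rewrite -bigcup_seq => -[S _ [/= -> ]].
by apply: bigsetU_measurable => S _; apply: measurableI.
Qed.

(** * Identification of the null distribution *)

(** Equal laws have densities that agree almost everywhere; a strict inequality
at one point would persist, by continuity, on an interval of positive length. *)
Lemma normal_pdf_le_of_eq_prob (R : realType) (m s m' s' : R) :
  0 < s -> 0 < s' ->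
  (forall A : set R, measurable A -> normal_prob m s A = normal_prob m' s' A) ->
  forall x, normal_pdf m s x <= normal_pdf m' s' x.
Proof.
move=> s0 s'0 E x; rewrite leNgt; apply/negP => gf.
pose f := normal_pdf m s; pose g := normal_pdf m' s'.
have cfg : continuous (fun z => f z - g z).
  move=> z; apply: (@continuousB _ R^o).
    by apply: continuous_normal_pdf; rewrite gt_eqF.
  by apply: continuous_normal_pdf; rewrite gt_eqF.
have : \forall z \near x, 0 < f z - g z.
  by apply: (cvgr_gt _ (cfg x)); rewrite subr_gt0.
move=> /nbhs_ballP[r /= r0 xr].
have [] : ae_eq (@lebesgue_measure R) setT (EFin \o f) (EFin \o g).
  apply: integral_ae_eq.
  - exact: measurableT.
  - exact: integrable_normal_pdf.
  - by apply/measurable_EFinP; exact: measurable_normal_pdf.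
  - by move=> A _ mA; exact: E.
move=> N [mN N0 fgN].
have : (lebesgue_measure (ball x r) <= lebesgue_measure N)%E.
  rewrite le_measure ?inE//; first exact: measurable_ball.
  by move=> z /xr fgz; apply: fgN => /= /(_ I)[] /eqP; rewrite -subr_eq0 gt_eqF.
rewrite N0 (lebesgue_measure_ball _ (ltW r0)) => le0.
have : ((r *+ 2)%:E <= 0%:E)%E := le0.
by rewrite lee_fin leNgt pmulrn_lgt0// r0.
Qed.

(** Comparing the two densities at both means shows that the peaks have the same
height, hence that the standard deviations agree, and then the means. *)
Lemma normal_prob_inj (R : realType) (m s m' s' : R) : 0 < s -> 0 < s' ->
  (forall A : set R, measurable A -> normal_prob m s A = normal_prob m' s' A) ->
  m = m' /\ s = s'.
Proof.
move=> s0 s'0 E.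
have fg x : normal_pdf m s x = normal_pdf m' s' x.
  apply: le_anti; apply/andP; split.
    exact: (normal_pdf_le_of_eq_prob s0 s'0 E).
  exact: (normal_pdf_le_of_eq_prob s'0 s0 (fun A mA => esym (E A mA))).
have sn0 : s != 0 by rewrite gt_eqF.
have sn0' : s' != 0 by rewrite gt_eqF.
rewrite !normal_pdfE// in fg.
have F1 (a b : R) : normal_fun a b a = 1.
  by rewrite /normal_fun subrr expr0n/= oppr0 mul0r expR0.
have F2 (a b c : R) : normal_fun a b c <= 1.
  rewrite /normal_fun -[leRHS]expR0 ler_expR mulNr oppr_le0.
  by rewrite mulr_ge0 ?sqr_ge0// invr_ge0 mulrn_wge0 ?sqr_ge0.
have peak : normal_peak s = normal_peak s'.
  apply/eqP; rewrite eq_le; apply/andP; split.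
    by have := fg m; rewrite F1 mulr1 => ->; rewrite ler_piMr ?normal_peak_ge0.
  by have := fg m'; rewrite F1 mulr1 => <-; rewrite ler_piMr ?normal_peak_ge0.
split.
  have := fg m; rewrite F1 peak => /(mulfI _); rewrite gt_eqF ?normal_peak_gt0//.
  move=> /(_ isT)/esym; rewrite /normal_fun -[RHS]expR0 => /expR_inj/eqP; rewrite mulf_eq0.
  rewrite oppr_eq0 sqrf_eq0 subr_eq0 invr_eq0 mulrn_eq0/= sqrf_eq0 (negbTE sn0') orbF.
  by move/eqP.
move: peak => /invr_inj/eqP; rewrite eqr_sqrt; last 2 first.
- by rewrite mulrn_wge0// mulr_ge0 ?sqr_ge0 ?pi_ge0.
- by rewrite mulrn_wge0// mulr_ge0 ?sqr_ge0 ?pi_ge0.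
rewrite eqr_pMn2r// => /eqP/(mulIf (lt0r_neq0 (pi_gt0 R)))/eqP.
by rewrite eqrXn2 ?ltW// => /eqP.
Qed.

(** Real numbers carry two measurable structures with the same measurable sets
but different displays; pushing forward along the identity moves the Gaussian
measure to the one used for tuples. *)
Definition normal_law {R : realType} (m s : R) : probability R R :=
  let id_ : measurableTypeR R -> R := idfun in
  distribution (normal_prob m s)
    (HB.pack id_ (isMeasurableFun.Build _ _ _ _ id_ (@measurable_id _ _ setT))
     : {mfun measurableTypeR R >-> R}).

Lemma marginal_contaminated (R : realType) (n : nat) (g0 g1 : probability R R)
    (Z : {ffun 'I_n -> bool}) (i : 'I_n) (A : set R) : measurable A ->
  marginal (contaminated g0 g1 Z) i A = if Z i then g1 A else g0 A.
Proof.
by move=> mA; rewrite [LHS]marginal_product_measure//; case: ifP.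
Qed.

Lemma gaussian_coordinates_contaminated (R : realType) (n : nat) (m s : R)
    (g1 : probability R R) (Z : {ffun 'I_n -> bool}) :
  (exists2 A : set R, measurable A & g1 A <> normal_prob m s A) ->
  gaussian_coordinates (contaminated (normal_law m s) g1 Z) m s =
  (~: [set i | Z i])%SET.
Proof.
move=> g10; apply/setP => i; rewrite !inE; apply/asboolP/idP => [h|/negbTE Zi A mA].
  apply/negP => Zi; have [A mA] := g10; apply.
  by have := h A mA; rewrite marginal_contaminated// Zi.
by rewrite marginal_contaminated// Zi.
Qed.

Lemma majorities_meet (R : realType) (n a b : nat) :
  n%:R / 2 < a%:R :> R -> n%:R / 2 < b%:R :> R -> (n < a + b)%N.
Proof. by move=> na nb; rewrite -(ltr_nat R) natrD; lra. Qed.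

(** Two strict majorities share a coordinate, whose law is Gaussian for both
couples of parameters. *)
Lemma null_parameters_unique (R : realType) (n : nat)
    (P : probability (n.-tuple R) R) (a b : R * R) :
  null_parameters P a -> null_parameters P b -> a = b.
Proof.
move=> [a0 Pa] [b0 Pb].
set A := gaussian_coordinates P a.1 a.2 in Pa.
set B := gaussian_coordinates P b.1 b.2 in Pb.
have /card_gt0P[i] : (0 < #|A :&: B|)%N.
  have nAB := majorities_meet Pa Pb.
  rewrite -(ltn_add2l #|A :|: B|) addn0 cardsUI; apply: leq_ltn_trans nAB.
  by rewrite -[leqRHS](card_ord n) max_card.
rewrite finset.in_setI => /andP[iA iB].
have ia : gaussian_marginal P a.1 a.2 i by move: iA; rewrite finset.in_set => /asboolP.
have ib : gaussian_marginal P b.1 b.2 i by move: iB; rewrite finset.in_set => /asboolP.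
have [] := @normal_prob_inj R a.1 a.2 b.1 b.2 a0 b0.
  by move=> D mD; rewrite -(ia D mD) (ib D mD).
by case: a {Pa A iA ia a0} => ? ?; case: b {Pb B iB ib b0} => ? ? /= -> ->.
Qed.

Lemma contaminated_model (R : realType) (n : nat) (m s : R)
    (g1 : probability R R) (Z : {ffun 'I_n -> bool}) :
  0 < s -> (exists2 A : set R, measurable A & g1 A <> normal_prob m s A) ->
  (ones Z)%:R < n%:R / 2 :> R ->
  let P := contaminated (normal_law m s) g1 Z in
  [/\ calP P, theta P = m, sigma P = s & false_nulls P = [set i | Z i]%SET].
Proof.
move=> s0 g10 Zn P.
have npP : null_parameters P (m, s).
  split => //=; rewrite gaussian_coordinates_contaminated// cardsCs finset.setCK card_ord.
  rewrite natrB; last by rewrite (leq_trans (max_card _))// card_ord.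
  by rewrite -/(ones Z); lra.
have tsP : theta_sigma P = (m, s).
  by rewrite /theta_sigma; case: xgetP => [ts _ /null_parameters_unique|/(_ _ npP)//]; exact.
split.
- by split; [exact: product_measure_product_distribution | exists (m, s)].
- by rewrite /theta tsP.
- by rewrite /sigma tsP.
- rewrite /false_nulls /true_nulls /theta /sigma tsP/=.
  by rewrite gaussian_coordinates_contaminated// finset.setCK.
Qed.

(** * False discoveries among the observations of a given region *)

Definition majority_in {R : realType} {n : nat}
    (rej : n.-tuple R -> {set 'I_n}) (V : set R) : set (n.-tuple R) :=
  [set y | (0 < #|rej y|)%N /\
    (#|rej y| <= 2 * #|(rej y :&: [set i | `[< V (tnth y i) >]])%SET|)%N].

Lemma measurable_majority_in (R : realType) (n : nat)
    (rej : n.-tuple R -> {set 'I_n}) (V : set R) :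
  multiple_testing_procedure rej -> measurable V ->
  measurable (majority_in rej V).
Proof.
move=> mrej mV; pose F (A : {set 'I_n}) := [set y : n.-tuple R | (0 < #|A|)%N /\
  (#|A| <= 2 * #|(A :&: [set i | `[< V (tnth y i) >]])%SET|)%N].
apply: (measurable_rejections (E := F) mrej) => A.
exact: (@measurable_hits R n V
  [set D | (0 < #|A|)%N /\ (#|A| <= 2 * #|(A :&: D)%SET|)%N]).
Qed.

(** When the false nulls almost surely avoid [U], all rejections in [U] are false
discoveries. If they make up half of the rejections, the false discovery proportion is at
least one half, and Markov's inequality applies. *)
Lemma FDR_majority_bound (R : realType) (n : nat)
    (P : probability (n.-tuple R) R) (rej : n.-tuple R -> {set 'I_n})
    (U : set R) (c : R) :
  multiple_testing_procedure rej -> measurable U ->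
  (forall i, i \in false_nulls P -> marginal P i U = 0%E) ->
  (FDR P rej <= c%:E)%E ->
  (P (majority_in rej U) <= (2 * c)%:E)%E.
Proof.
move=> mrej mU PU FDRc.
set S := majority_in rej U.
pose E := [set y | 1 / 2 <= FDP P (rej y)].
have mE : measurable E by exact: (mrej [set A | 1 / 2 <= FDP P A]).
have FDP0 A : 0 <= FDP P A by rewrite divr_ge0.
have PE : (P E <= (2 * c)%:E)%E.
  have : ((1 / 2)%:E * P E <= FDR P rej)%E.
    rewrite /FDR expectation.unlock -[E]setIT -integral_indic//.
    rewrite -ge0_integralZl//; last by exact/measurable_EFinP/measurable_indic.
    apply: ge0_le_integral => //.
    - by apply/measurable_EFinP; apply: measurable_funM => //; exact: measurable_indic.
    - apply/measurable_EFinP => mT Y mY; rewrite setTI.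
      exact: (mrej [set A | Y (FDP P A)]).
    - move=> y _; rewrite -EFinM lee_fin indicE; case: (boolP (y \in E)).
        by rewrite inE mulr1.
      by rewrite mulr0.
  move=> /le_trans/(_ FDRc); rewrite -(fineK (fin_num_measure P E mE)).
  by rewrite -EFinM !lee_fin; lra.
have mUi i : measurable [set y : n.-tuple R | U (tnth y i)].
  exact: measurable_tnth_preimage.
pose B := \big[setU/set0]_(i in false_nulls P) [set y : n.-tuple R | U (tnth y i)].
have mB : measurable B by exact: bigsetU_measurable.
have PB : P B = 0%E.
  apply/eqP; rewrite eq_le measure_ge0 andbT.
  apply: (le_trans (@le_measure_bigsetU _ _ _ P _ _ (mem (false_nulls P)) _ mB mUi _)).
    by move=> y; rewrite /B -bigcup_seq_cond => -[i /= /andP[_ iF] Uy]; exists i.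
  by rewrite big1// => i iF; exact: PU.
have SE : S `<=` E `|` B.
  move=> y [/= R0 Rle].
  case: (pselect (B y)) => [By|nBy]; [by right|left].
  rewrite /E/= /FDP (maxn_idPl R0) ler_pdivlMr ?ltr0n//.
  have : (#|rej y :&: [set i | `[< U (tnth y i) >]]%SET| <=
    #|(rej y :&: true_nulls P)%SET|)%N.
    apply/subset_leq_card/fintype.subsetP => i.
    rewrite !finset.in_setI => /andP[-> /=]; rewrite inE => /asboolP Uy.
    apply/negPn/negP => iF; apply: nBy.
    rewrite /B -bigcup_seq_cond; exists i => //=.
    by rewrite mem_index_enum/= finset.in_setC.
  by move: Rle; rewrite -!(ler_nat R) natrM; lra.
have mS : measurable S by exact: measurable_majority_in.
apply: (le_trans (le_measure _ _ _ SE)); rewrite ?inE//; first exact: measurableU.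
apply: (le_trans (measureU2 _ mE mB)).
by rewrite [X in (_ + X)%E]PB adde0.
Qed.

(** * Two readings of the maximum of two densities *)

Lemma exists_density_law (R : realType) (h : R -> R) (c : R) :
  measurable_fun setT h -> (forall x, 0 <= h x) -> 0 < c ->
  (\int[lebesgue_measure]_x (h x)%:E = c%:E)%E ->
  exists P : probability R R, forall A : set R, measurable A ->
    (c%:E * P A = \int[lebesgue_measure]_(x in A) (h x)%:E)%E.
Proof.
move=> mh h0 c0 hc.
pose m (A : set (measurableTypeR R)) : \bar R :=
  (c^-1%:E * \int[lebesgue_measure]_(x in A) (h x)%:E)%E.
have mhE : measurable_fun setT (EFin \o h) by exact/measurable_EFinP.
have m0 : m set0 = 0%E by rewrite /m integral_set0 mule0.
have mge0 A : (0 <= m A)%E.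
  rewrite mule_ge0 ?lee_fin ?invr_ge0 ?(ltW c0)//; apply: integral_ge0 => x _.
  by rewrite lee_fin.
have ms : semi_sigma_additive m.
  move=> F mF tF mUF; rewrite /m ge0_integral_bigcup//; last 2 first.
    exact: measurable_funTS.
    by move=> x _; rewrite lee_fin.
  rewrite -nneseriesZl; last first.
    by move=> i _; apply: integral_ge0 => x _; rewrite lee_fin.
  by apply: is_cvg_ereal_nneg_natsum => i _; exact: mge0.
have m1 : m setT = 1%E.
  by rewrite /m hc -EFinM mulVf// gt_eqF.
pose M : {measure set (measurableTypeR R) -> \bar R} :=
  HB.pack m (isMeasure.Build _ (measurableTypeR R) R m m0 mge0 ms).
pose Pm : probability (measurableTypeR R) R :=
  HB.pack m (isMeasure.Build _ (measurableTypeR R) R m m0 mge0 ms)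
   (Measure_isProbability.Build _ (measurableTypeR R) R M m1).
pose id_ : measurableTypeR R -> R := idfun.
pose idm : {mfun measurableTypeR R >-> R} :=
  HB.pack id_ (isMeasurableFun.Build _ _ _ _ id_ (@measurable_id _ _ setT)).
exists (distribution Pm idm) => A mA.
rewrite /distribution /pushforward/= /m muleA -EFinM divff ?gt_eqF// mul1e.
by congr (\int[_]_(x in _) _)%E.
Qed.

(** Both mixtures are the normalization of [max f (rho g)]: the excess of
[rho g] over [f] completes [f], and the excess of [f] over [rho g] completes
[rho g]. The two excesses live on complementary sets. *)
Lemma exists_two_readings (R : realType) (f g : R -> R) (rho D : R) :
  measurable_fun setT f -> measurable_fun setT g ->
  (forall x, 0 <= f x) -> (forall x, 0 <= g x) ->
  (\int[leb]_x (f x)%:E = 1)%E -> (\int[leb]_x (g x)%:E = 1)%E ->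
  0 < rho -> rho < 1 + D -> 0 < D ->
  (\int[leb]_x (Num.max (rho * g x - f x) 0)%:E = D%:E)%E ->
  exists g1 g2 : probability R R,
    [/\ forall A : set R, measurable A ->
          ((1 - D / (1 + D))%:E * \int[leb]_(x in A) (f x)%:E + (D / (1 + D))%:E * g1 A =
           (1 - (1 + D - rho) / (1 + D))%:E * \int[leb]_(x in A) (g x)%:E
             + ((1 + D - rho) / (1 + D))%:E * g2 A)%E,
        forall A : set R, measurable A ->
          (D%:E * g1 A = \int[leb]_(x in A) (Num.max (rho * g x - f x) 0)%:E)%E,
        g1 (~` [set x | f x < rho * g x]) = 0%E &
        g2 [set x | f x < rho * g x] = 0%E].
Proof.
move=> mf mg f0 g0 f1 g1 r0 rD D0 hD.
pose h1 x := Num.max (rho * g x - f x) 0.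
pose h2 x := Num.max (f x - rho * g x) 0.
have mrg : measurable_fun setT (fun x => rho * g x) by exact: measurable_funM.
have mh1 : measurable_fun setT h1 by apply: measurable_maxr => //; exact: measurable_funB.
have mh2 : measurable_fun setT h2 by apply: measurable_maxr => //; exact: measurable_funB.
have h10 x : 0 <= h1 x by rewrite le_max lexx orbT.
have h20 x : 0 <= h2 x by rewrite le_max lexx orbT.
have hE x : f x + h1 x = rho * g x + h2 x.
  rewrite /h1 /h2 /Order.max; case: (ltP (rho * g x - f x) 0) => a.
    by case: (ltP (f x - rho * g x) 0) => b; lra.
  by case: (ltP (f x - rho * g x) 0) => b; lra.
have intE (A : set R) : measurable A ->
    (\int[leb]_(x in A) (f x)%:E + \int[leb]_(x in A) (h1 x)%:E =
     rho%:E * \int[leb]_(x in A) (g x)%:E + \int[leb]_(x in A) (h2 x)%:E)%E.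
  move=> mA.
  rewrite -ge0_integralZl_EFin ?(ltW r0)//; last 2 first.
    by move=> x _; rewrite lee_fin.
    by apply/measurable_EFinP; exact: measurable_funTS.
  have mE (k : R -> R) : measurable_fun setT k -> measurable_fun A (EFin \o k).
    by move=> mk; apply/measurable_EFinP; exact: measurable_funTS.
  rewrite -!ge0_integralD//; try exact: mE;
    try by [move=> x _; rewrite -?EFinM lee_fin// mulr_ge0// ltW].
  by apply: eq_integral => x _; rewrite -EFinM -!EFinD hE.
have h2E : (\int[leb]_x (h2 x)%:E = (1 + D - rho)%:E)%E.
  have := intE _ measurableT; rewrite f1 g1 hD mule1.
  case: (\int[leb]_x (h2 x)%:E)%E => [r| |]//= -[].
  by move=> e; congr (_%:E); lra.
have E0 : 0 < 1 + D - rho by lra.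
have [G1 G1E] := exists_density_law mh1 h10 D0 hD.
have [G2 G2E] := exists_density_law mh2 h20 E0 h2E.
have mU : measurable [set x : R | f x < rho * g x].
  rewrite (_ : [set x | _] = (fun x => rho * g x - f x) @^-1` `]0, +oo[).
    rewrite -[X in measurable X]setTI.
    have mw : measurable_fun setT (fun x => rho * g x - f x) by exact: measurable_funB.
    by apply: mw => //; exact: measurable_itv.
  by apply/seteqP; split => x /=; rewrite in_itv/= andbT subr_gt0.
have finE (k : R -> R) (A : set R) : measurable_fun setT k -> (forall x, 0 <= k x) ->
    (\int[leb]_x (k x)%:E = 1)%E -> measurable A ->
    exists r, (\int[leb]_(x in A) (k x)%:E = r%:E)%E.
  move=> mk k0 k1 mA; exists (fine (\int[leb]_(x in A) (k x)%:E)%E).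
  rewrite fineK// ge0_fin_numE; last by apply: integral_ge0 => x _; rewrite lee_fin.
  apply: (@le_lt_trans _ _ 1%E); last exact: ltry.
  rewrite -k1; apply: ge0_subset_integral => //; first exact/measurable_EFinP.
  by move=> x _; rewrite lee_fin.
exists G1, G2; split => //.
- move=> A mA; have := intE A mA; rewrite -G1E// -G2E//.
  have [a ->] := finE f A mf f0 f1 mA; have [b ->] := finE g A mg g0 g1 mA.
  rewrite -(fineK (fin_num_measure G1 A mA)) -(fineK (fin_num_measure G2 A mA)).
  set u := fine (G1 A); set v := fine (G2 A).
  rewrite -!EFinM -!EFinD => -[e]; congr (_%:E).
  have D1 : 1 + D != 0 by rewrite gt_eqF// addr_gt0.
  apply: (mulfI D1); transitivity (a + D * u); first by field.
  by rewrite e; field.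
- have : (D%:E * G1 (~` [set x | (f x < rho * g x)%R]) = 0)%E.
    rewrite G1E; last exact: measurableC.
    apply: integral0_eq => x /= /negP; rewrite -leNgt => h.
    by rewrite /h1 max_r ?subr_le0.
  by move/eqP; rewrite mule_eq0 => /orP[/eqP[] D00|/eqP//]; rewrite D00 ltxx in D0.
- have : ((1 + D - rho)%:E * G2 [set x | (f x < rho * g x)%R] = 0)%E.
    rewrite G2E//; apply: integral0_eq => x /= h.
    by rewrite /h2 max_r// subr_le0 ltW.
  by move/eqP; rewrite mule_eq0 => /orP[/eqP[] D00|/eqP//]; rewrite D00 ltxx in E0.
Qed.

(** * Gaussian densities with different variances *)

Lemma normal_pdf_std (R : realType) (x : R) :
  normal_pdf 0 1 x = normal_peak 1 * expR (- (x ^+ 2 / 2)).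
Proof.
rewrite normal_pdfE ?oner_neq0// /normal_fun subr0 expr1n; congr (_ * expR _).
by rewrite mulNr.
Qed.

Lemma normal_pdf_precision (R : realType) (c x : R) : 0 < c ->
  normal_pdf 0 c^-1 x = c * normal_peak 1 * expR (- (c ^+ 2 * x ^+ 2 / 2)).
Proof.
move=> c0; rewrite normal_pdfE ?invr_eq0 ?gt_eqF// /normal_fun subr0.
congr (_ * expR _).
  rewrite /normal_peak -mulrnAr sqrtrM ?sqr_ge0// sqrtr_sqr ger0_norm ?invr_ge0 ?ltW//.
  by rewrite invfM invrK expr1n mul1r.
by rewrite exprVn -mulr_natr; field; rewrite gt_eqF.
Qed.

(** Raising the variance from [1] to [1 / (1 - b)] multiplies the density by a
quadratic exponential; the weight in front is chosen so that the two densities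
cross at [x^2 = t2]. *)
Lemma normal_pdf_tilt (R : realType) (b t2 x : R) : b < 1 ->
  expR (- (b * t2 / 2)) / Num.sqrt (1 - b) *
    normal_pdf 0 (Num.sqrt (1 - b))^-1 x =
  normal_pdf 0 1 x * expR (b * (x ^+ 2 - t2) / 2).
Proof.
move=> b1; have c0 : 0 < Num.sqrt (1 - b) by rewrite sqrtr_gt0 subr_gt0.
rewrite normal_pdf_precision// normal_pdf_std sqr_sqrtr ?subr_ge0 ?ltW//.
set c := Num.sqrt (1 - b) in c0 *.
have -> : expR (- ((1 - b) * x ^+ 2 / 2)) =
    expR (- (x ^+ 2 / 2)) * expR (b * x ^+ 2 / 2).
  by rewrite -expRD; congr expR; field.
have -> : expR (b * (x ^+ 2 - t2) / 2) =
    expR (- (b * t2 / 2)) * expR (b * x ^+ 2 / 2).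
  by rewrite -expRD; congr expR; field.
by field; rewrite gt_eqF.
Qed.

(** Convexity of the exponential between [0] and [v]. *)
Lemma expR_chord (R : realType) (l v : R) : 0 <= l <= 1 ->
  expR (l * v) - 1 <= l * expR v.
Proof.
move=> /andP[l0 l1].
have := @convex_expR R (Itv01 l0 l1) v 0.
rewrite !convRE/= mulr0 addr0 expR0 mulr1 /unstable.onem; lra.
Qed.

(** The excess of the widened density over the standard one, see
[normal_pdf_tilt]. *)
Definition excess {R : realType} (b t2 x : R) : R :=
  Num.max (normal_pdf 0 1 x * expR (b * (x ^+ 2 - t2) / 2) - normal_pdf 0 1 x) 0.

(** A direct bound of the exponential would lose the factor [b], which is needed
since [b] may be as small as [1 / ln n]. The chord inequality compares the tilt
by [b] to the tilt by [1 / 2] and keeps this factor; the latter tilt turns the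
standard density into that of variance [2]. *)
Lemma excess_ub (R : realType) (b t2 x : R) : 0 <= b <= 1 / 2 ->
  excess b t2 x <=
    3 * b * expR (- (t2 / 4)) * normal_pdf 0 (Num.sqrt (1 / 2))^-1 x.
Proof.
move=> /andP[b0 b2].
have c0 : 0 < Num.sqrt (1 / 2) :> R by rewrite sqrtr_gt0 divr_gt0.
rewrite normal_pdf_precision// sqr_sqrtr ?divr_ge0// /excess normal_pdf_std.
set c := Num.sqrt (1 / 2) in c0 *.
have c1 : 2 <= 3 * c.
  rewrite -(@ler_pXn2r _ 2) ?nnegrE ?mulr_ge0 ?(ltW c0)// exprMn /c sqr_sqrtr ?divr_ge0//.
  lra.
have pk := normal_peak_ge0 (1 : R).
rewrite ge_max; apply/andP; split; last by rewrite !mulr_ge0 ?expR_ge0 ?(ltW c0).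
have : expR (b * (x ^+ 2 - t2) / 2) - 1 <= 2 * b * expR ((x ^+ 2 - t2) / 4).
  have -> : b * (x ^+ 2 - t2) / 2 = (2 * b) * ((x ^+ 2 - t2) / 4) by field.
  by apply: expR_chord; lra.
set p := normal_peak 1 in pk *; set E := expR (- (x ^+ 2 / 2)).
move=> h; apply: (@le_trans _ _ (p * E * (2 * b * expR ((x ^+ 2 - t2) / 4)))).
  rewrite -[X in _ - X]mulr1 -mulrBr ler_wpM2l//.
  by rewrite mulr_ge0 ?expR_ge0.
have eE : E * expR ((x ^+ 2 - t2) / 4) =
    expR (- (t2 / 4)) * expR (- (1 / 2 * x ^+ 2 / 2)).
  by rewrite /E -!expRD; congr expR; field.
rewrite [leLHS](_ : _ = 2 * b * p * (E * expR ((x ^+ 2 - t2) / 4))); last by ring.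
rewrite eE.
rewrite [leRHS](_ : _ = 3 * c * b * p * (expR (- (t2 / 4)) * expR (- (1 / 2 * x ^+ 2 / 2)))).
  by rewrite ler_wpM2r ?mulr_ge0 ?expR_ge0// !ler_wpM2r.
by ring.
Qed.

Lemma measurable_excess (R : realType) (b t2 : R) : measurable_fun setT (excess b t2).
Proof.
apply: measurable_maxr => //; apply: measurable_funB; last exact: measurable_normal_pdf.
apply: measurable_funM; first exact: measurable_normal_pdf.
apply: measurableT_comp => //; apply: measurable_funM => //.
by apply: measurable_funM => //; apply: measurable_funB.
Qed.

Lemma excess_ge0 (R : realType) (b t2 x : R) : 0 <= excess b t2 x.
Proof. by rewrite le_max lexx orbT. Qed.

Lemma integral_excess_ub (R : realType) (b t2 : R) : 0 <= b <= 1 / 2 ->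
  (\int[leb]_x (excess b t2 x)%:E <= (3 * b * expR (- (t2 / 4)))%:E)%E.
Proof.
move=> b2; have b0 : 0 <= b by case/andP: b2.
rewrite -[leRHS]mule1 -(@integral_normal_pdf R 0 (Num.sqrt (1 / 2))^-1).
rewrite -ge0_integralZl_EFin//; last 3 first.
- by move=> x _; rewrite lee_fin normal_pdf_ge0.
- by apply/measurable_EFinP; exact: measurable_normal_pdf.
- by rewrite !mulr_ge0 ?expR_ge0.
apply: ge0_le_integral => //.
- by move=> x _; rewrite lee_fin excess_ge0.
- by apply/measurable_EFinP; exact: measurable_excess.
- by apply/measurable_EFinP; apply: measurable_funM => //; exact: measurable_normal_pdf.
- by move=> x _; rewrite -EFinM lee_fin excess_ub.
Qed.

Lemma integral_excess_lb (R : realType) (b t2 x0 : R) : 0 <= b -> 0 <= x0 ->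
  t2 <= x0 ^+ 2 ->
  ((expR (b * (x0 ^+ 2 - t2) / 2) - 1)%:E * normal_prob 0 1 `]x0, +oo[ <=
   \int[leb]_(x in `]x0, +oo[) (excess b t2 x)%:E)%E.
Proof.
move=> b0 x00 tx0; rewrite /normal_prob -ge0_integralZl_EFin//; last 3 first.
- by move=> x _; rewrite lee_fin normal_pdf_ge0.
- by apply/measurable_EFinP/measurable_funTS; exact: measurable_normal_pdf.
- by rewrite subr_ge0 -expR0 ler_expR divr_ge0// mulr_ge0// subr_ge0.
apply: ge0_le_integral => //.
- move=> x _; rewrite -EFinM lee_fin mulr_ge0 ?normal_pdf_ge0//.
  by rewrite subr_ge0 -expR0 ler_expR divr_ge0// mulr_ge0// subr_ge0.
- apply/measurable_EFinP/measurable_funTS; apply: measurable_funM => //.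
  exact: measurable_normal_pdf.
- by apply/measurable_EFinP/measurable_funTS; exact: measurable_excess.
move=> x /=; rewrite in_itv/= andbT => xx0; rewrite -EFinM lee_fin le_max.
apply/orP; left; rewrite mulrBl mul1r lerB// mulrC ler_wpM2l ?normal_pdf_ge0//.
rewrite ler_expR ler_pM2r// ler_wpM2l// lerB//.
have x0' := le_trans x00 (ltW xx0).
by rewrite ler_pXn2r ?nnegrE// ltW.
Qed.

(** Between [x] and [x + 1/x] the square increases by at most [3], so that the
density stays comparable to its value at [x]. *)
Lemma normal_upper_tail_lb (R : realType) (x : R) : 1 <= x ->
  ((normal_peak 1 * expR (- (3 / 2)) * (expR (- (x ^+ 2 / 2)) / x))%:E <=
   normal_prob 0 1 `]x, +oo[)%E.
Proof.
move=> x1; have x0 : 0 < x by rewrite (lt_le_trans ltr01).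
have xv0 : 0 < x^-1 by rewrite invr_gt0.
pose z := x + x^-1.
have sub : [set` `]x, z]] `<=` [set` `]x, +oo[].
  by apply: subset_itvl; rewrite bnd_simp.
apply: (@le_trans _ _ (normal_prob 0 1 `]x, z])); last first.
  by rewrite le_measure ?inE.
rewrite /normal_prob.
apply: (@le_trans _ _ (\int[leb]_(y in `]x, z])
   (normal_peak 1 * expR (- (3 / 2)) * expR (- (x ^+ 2 / 2)))%:E)%E).
  rewrite integral_cst//= lebesgue_measure_itv/= lte_fin ltrDl xv0 /z.
  by rewrite -EFinB -EFinM lee_fin addrAC subrr add0r mulrA.
apply: ge0_le_integral => //.
- by move=> y _; rewrite lee_fin !mulr_ge0 ?expR_ge0 ?normal_peak_ge0.
- by apply/measurable_EFinP/measurable_funTS; exact: measurable_normal_pdf.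
move=> y /=; rewrite in_itv/= => /andP[xy yx]; rewrite lee_fin normal_pdf_std.
rewrite -mulrA ler_wpM2l ?normal_peak_ge0// -expRD ler_expR.
have y2 : y ^+ 2 <= (x + x^-1) ^+ 2.
  have y0 := lt_trans x0 xy.
  by rewrite ler_pXn2r ?nnegrE// ltW// addr_gt0.
have : (x + x^-1) ^+ 2 <= x ^+ 2 + 3.
  have -> : (x + x^-1) ^+ 2 = x ^+ 2 + 2 + x^-1 ^+ 2 by field; rewrite gt_eqF.
  have : x^-1 ^+ 2 <= 1 by rewrite exprn_ile1 ?(ltW xv0) ?invf_le1.
  lra.
lra.
Qed.

(** The law contaminating one reading ignores a set that the other reading
charges, so it is not the null law. This guarantees that the contaminated
coordinates are exactly the false nulls. *)
Lemma reading_differs (R : realType) (f0 h0 g1 g2 : probability R R) (p q : R)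
    (V : set R) : measurable V -> 0 < q <= 1 ->
  ((1 - p)%:E * f0 V + p%:E * g1 V = (1 - q)%:E * h0 V + q%:E * g2 V)%E ->
  g1 V = 0%E -> g2 (~` V) = 0%E ->
  exists2 A : set R, measurable A & g1 A <> f0 A.
Proof.
move=> mV /andP[q0 q1] E g1V g2V; exists V => //; rewrite g1V => f0V.
have : (g2 V = 1)%E.
  have := probability_setC g2 (measurableC mV); rewrite setCK => ->.
  by rewrite g2V sube0.
move=> g21; move: E; rewrite -f0V g1V g21 !mule0 adde0 mule1.
rewrite -(fineK (fin_num_measure h0 V mV)) -EFinM -EFinD => -[] e.
have : 0 <= (1 - q) * fine (h0 V).
  by rewrite mulr_ge0 ?subr_ge0// fine_ge0.
lra.
Qed.

(** The weight [rho] of the widened density must be less than [1] for the second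
reading to be a genuine mixture; this is where [4 <= t2] enters. *)
Lemma exists_normal_readings (R : realType) (b t2 x0 : R) :
  0 < b <= 1 / 4 -> 4 <= t2 -> 0 <= x0 -> t2 < x0 ^+ 2 ->
  exists (s p q : R) (g1 g2 : probability R R) (U : set R),
  [/\ [/\ 0 < s, 0 < p <= 1 & 0 < q <= 1],
      p <= 3 * b * expR (- (t2 / 4)) /\
      q <= b * t2 / 2 + 3 * b * expR (- (t2 / 4)),
      forall A : set R, measurable A ->
        ((1 - p)%:E * normal_law 0 1 A + p%:E * g1 A =
         (1 - q)%:E * normal_law 0 s A + q%:E * g2 A)%E,
      [/\ measurable U, g1 (~` U) = 0%E & g2 U = 0%E] &
      (((expR (b * (x0 ^+ 2 - t2) / 2) - 1) / 2)%:E * normal_prob 0 1 `]x0, +oo[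
        <= p%:E * g1 [set` `]x0, +oo[])%E].
Proof.
move=> /andP[b0 b4] t4 x00 tx.
have x01 : 1 <= x0.
  by rewrite -(@ler_pXn2r _ 2) ?nnegrE// expr1n; lra.
pose c : R := Num.sqrt (1 - b).
have c0 : 0 < c by rewrite sqrtr_gt0; lra.
have cc : c ^+ 2 = 1 - b by rewrite sqr_sqrtr//; lra.
have c1 : c <= 1 by rewrite -(@ler_pXn2r _ 2) ?nnegrE ?(ltW c0)// cc expr1n; lra.
pose rho := expR (- (b * t2 / 2)) / c.
have r0 : 0 < rho by rewrite divr_gt0 ?expR_gt0.
have b12 : 0 <= b <= 1 / 2 by lra.
have rho1 : rho < 1.
  rewrite ltr_pdivrMr// mul1r -(@ltr_pXn2r _ 2) ?nnegrE ?expR_ge0 ?(ltW c0)// cc.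
  rewrite -expRM_natl.
  apply: (@le_lt_trans _ _ (expR (- (4 * b)))).
    rewrite ler_expR; nra.
  have b1 : b < 1 by lra.
  have e4b : (1 - b)^-1 < expR (4 * b).
    apply: (@lt_le_trans _ _ (1 + 4 * b)); last exact: expR_ge1Dx.
    by rewrite -[ltLHS]mul1r ltr_pdivrMr ?subr_gt0//; nra.
  by rewrite expRN -[ltRHS]invrK ltf_pV2 ?posrE ?expR_gt0 ?invr_gt0 ?subr_gt0.
have rhoge : 1 - b * t2 / 2 <= rho.
  apply: (@le_trans _ _ (expR (- (b * t2 / 2)))); first exact: expR_ge1Dx.
  by rewrite ler_peMr ?expR_ge0// -[leLHS]invr1 lef_pV2 ?posrE.
pose g := normal_pdf 0 c^-1.
(* The tail region [f < rho g] is [t2 < x^2], but its description by densities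
   is the one that [exists_two_readings] needs. *)
have excessE x : excess b t2 x = Num.max (rho * g x - normal_pdf 0 1 x) 0.
  by rewrite /g /rho normal_pdf_tilt//; lra.
pose D := fine (\int[leb]_x (excess b t2 x)%:E)%E.
have ub := integral_excess_ub t2 b12.
have ge0I : (0 <= \int[leb]_x (excess b t2 x)%:E)%E.
  by apply: integral_ge0 => x _; rewrite lee_fin excess_ge0.
have DE : (\int[leb]_x (excess b t2 x)%:E = D%:E)%E.
  by rewrite fineK// ge0_fin_numE// (le_lt_trans ub)// ltry.
have Dub : D <= 3 * b * expR (- (t2 / 4)) by rewrite -lee_fin -DE.
set K := expR (b * (x0 ^+ 2 - t2) / 2).
have K1 : 1 < K by rewrite -expR0 ltr_expR divr_gt0// mulr_gt0// subr_gt0.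
have lb := integral_excess_lb (ltW b0) x00 (ltW tx).
have tail0 : (0 < normal_prob 0 1 `]x0, +oo[)%E.
  apply: lt_le_trans (normal_upper_tail_lb x01).
  rewrite lte_fin !mulr_gt0 ?expR_gt0 ?normal_peak_gt0 ?oner_neq0//.
  by rewrite invr_gt0 (lt_le_trans ltr01).
have D0 : 0 < D.
  rewrite -lte_fin -DE; apply: (@lt_le_trans _ _ (\int[leb]_(x in `]x0, +oo[) (excess b t2 x)%:E)%E).
    by apply: lt_le_trans lb; rewrite mule_gt0// lte_fin subr_gt0.
  apply: ge0_subset_integral => //.
    by apply/measurable_EFinP; exact: measurable_excess.
  by move=> x _; rewrite lee_fin excess_ge0.
have D1 : D <= 1.
  apply: (le_trans Dub); have : expR (- (t2 / 4)) <= 1.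
    by rewrite -[leRHS]expR0 ler_expR; lra.
  have := expR_ge0 (- (t2 / 4)); nra.
have [||||||||||g1 [g2 [mix g1E g1U g2U]]] :=
  @exists_two_readings R (normal_pdf 0 1) g rho D.
- exact: measurable_normal_pdf.
- exact: measurable_normal_pdf.
- by move=> x; exact: normal_pdf_ge0.
- by move=> x; exact: normal_pdf_ge0.
- exact: integral_normal_pdf.
- exact: integral_normal_pdf.
- exact: r0.
- lra.
- exact: D0.
- by rewrite -DE; apply: eq_integral => x _; rewrite excessE.
have D10 : 0 < 1 + D by lra.
exists c^-1, (D / (1 + D)), ((1 + D - rho) / (1 + D)), g1, g2,
  [set x | normal_pdf 0 1 x < rho * g x].
split => //.
- split; first by rewrite invr_gt0.
    by rewrite divr_gt0//= ler_pdivrMr//; lra.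
  by rewrite divr_gt0 ?ler_pdivrMr//=; lra.
- split.
    by rewrite ler_pdivrMr//; nra.
  rewrite ler_pdivrMr//.
  apply: (@le_trans _ _ (b * t2 / 2 + D)); first by lra.
  rewrite -[leLHS]mulr1; apply: ler_pM => //; nra.
- split => //.
  rewrite (_ : [set x | _] = (fun x => rho * g x - normal_pdf 0 1 x) @^-1` `]0, +oo[).
    rewrite -[X in measurable X]setTI.
    have mw : measurable_fun setT (fun x => rho * g x - normal_pdf 0 1 x).
      apply: measurable_funB; last exact: measurable_normal_pdf.
      by apply: measurable_funM => //; exact: measurable_normal_pdf.
    by apply: mw => //; exact: measurable_itv.
  by apply/seteqP; split => x /=; rewrite in_itv/= andbT subr_gt0.
- rewrite -/K; set G := g1 _; set N := normal_prob _ _ _.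
  have : ((K - 1)%:E * N <= D%:E * G)%E.
    rewrite /G g1E//; apply: (le_trans lb).
    by rewrite le_eqVlt; apply/orP; left; apply/eqP; apply: eq_integral => x _; rewrite excessE.
  have [fG fN] : G \is a fin_num /\ N \is a fin_num.
    by split; apply: fin_num_measure.
  have G0 : 0 <= fine G by rewrite /G fine_ge0.
  rewrite -(fineK fG) -(fineK fN) -!EFinM !lee_fin => h.
  have i2 : 1 / 2 <= (1 + D)^-1.
    by rewrite mul1r lef_pV2 ?posrE//; lra.
  have DG : 0 <= D * fine G by rewrite mulr_ge0// ltW.
  by nra.
Qed.

(** * Power of the oracle *)

(** The level [2 * upper_tail x0] is admissible as soon as enough observations
exceed [x0]; the count being at most [n], this level is automatically at most
[1]. *)
Lemma BH_rejects_above (R : realType) (n : nat) (a x0 : R) (y : n.-tuple R) :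
  0 < a <= 1 -> 0 <= x0 ->
  n%:R * (2 * upper_tail x0) / a <= #|[set i | (x0 < tnth y i)%R]%SET|%:R ->
  forall i, x0 < tnth y i -> i \in BH a y 0 1.
Proof.
move=> /andP[a0 a1] x00 cnt i xi.
have n0 : 0 < n%:R :> R by rewrite ltr0n; case: n y cnt i xi => // ? ? [].
have ple j : x0 < tnth y j -> pvalue y 0 1 j <= 2 * upper_tail x0.
  move=> xj; rewrite /pvalue subr0 divr1 ler_pM2l// upper_tail_nonincreasing//.
  by rewrite (le_trans (ltW xj))// ler_norm.
rewrite inE; apply: (le_trans (ple i xi)).
have [_] := BH_threshold_max y 0 1 a0; apply; split.
  have t0 : 0 <= upper_tail x0 by rewrite fine_ge0// measure_ge0.
  apply/andP; split; first by rewrite mulr_ge0.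
  apply: le_trans a1; rewrite -(ler_pM2l n0) -ler_pdivrMr//.
  apply: (le_trans cnt); rewrite ler_nat (leq_trans (max_card _))//.
  by rewrite card_ord.
apply: (le_trans cnt); rewrite ler_nat.
apply/subset_leq_card/fintype.subsetP => j; rewrite !inE; exact: ple.
Qed.

(** Only the contaminated coordinates exceeding [x0] are counted: they are
independent, each with the mass that [g1] gives beyond [x0], and as soon as
[s] of them occur all of them are rejected. *)
Lemma oracle_power (R : realType) (n : nat) (g1 : probability R R)
    (Z : {ffun 'I_n -> bool}) (a x0 s r : R) :
  (exists2 A : set R, measurable A & g1 A <> normal_prob 0 1 A) ->
  (ones Z)%:R < n%:R / 2 :> R -> 0 < a <= 1 -> 0 <= x0 ->
  n%:R * (2 * upper_tail x0) / a <= s -> r <= s ->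
  ((1 - expR (s - (ones Z)%:R * fine (g1 [set` `]x0, +oo[]) / 2))%:E <=
   contaminated (normal_law 0 1) g1 Z
     [set y | (r <= #|(oracle_BH (contaminated (normal_law 0 1) g1 Z) a y
                       :&: false_nulls (contaminated (normal_law 0 1) g1 Z))%SET|%:R)%R])%E.
Proof.
move=> g10 Zn a01 x00 sge rs; set P := contaminated _ _ _.
set G := fine _.
have a0 : 0 < a by case/andP: a01.
have [cP thP siP fP] := contaminated_model ltr01 g10 Zn.
rewrite fP; set B := (X in (_ <= P X)%E).
have mB : measurable B.
  have := @multiple_testing_procedure_BH R n a 0 1 a0
    [set D | r <= #|(D :&: [set i | Z i])%SET|%:R].
  by rewrite /B /oracle_BH thP siP.
(* Empty target sets discard the coordinates that are not contaminated. *)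
pose V i : set R := if Z i then [set` `]x0, +oo[] else set0.
have mV i : measurable (V i) by rewrite /V; case: ifP => _; [exact: measurable_itv|].
pose C := [set y : n.-tuple R | #|[set i | `[< V i (tnth y i) >]]%SET|%:R < s].
have [mC PC] := @product_measure_count R n (fun i => if Z i then g1 else normal_law 0 1) V s mV.
have sub : ~` C `<=` B.
  move=> y /= /negP; rewrite -leNgt => sC.
  have VE i : V i (tnth y i) -> Z i /\ x0 < tnth y i.
    by rewrite /V; case: ifP => //= Zi; rewrite in_itv/= andbT.
  rewrite /B/=; apply: (le_trans (le_trans rs sC)); rewrite ler_nat.
  apply/subset_leq_card/fintype.subsetP => i; rewrite !inE => Vi.
  have [Zi xi] := VE _ Vi.
  rewrite Zi andbT /oracle_BH thP siP.
  have : i \in BH a y 0 1; last by rewrite inE.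
  apply: BH_rejects_above x00 _ _ xi => //.
  apply: (le_trans sge); apply: (le_trans sC); rewrite ler_nat.
  by apply/subset_leq_card/fintype.subsetP => j; rewrite !inE => Vj; have [] := VE _ Vj.
apply: (@le_trans _ _ (P (~` C))); last first.
  by rewrite le_measure ?inE//; exact: measurableC.
rewrite probability_setC// EFinB leeB//; apply: (le_trans PC); rewrite lee_fin.
have p01 i : 0 <= fine ((if Z i then g1 else normal_law 0 1) (V i)) <= 1.
  exact: fine_probability_itv.
apply: (le_trans (bit_weight_lower_tail s p01)).
rewrite ler_expR lerD2l lerN2 ler_pM2r//.
rewrite onesE mulr_suml; apply: ler_sum => i _.
rewrite /V; case: (Z i); first by rewrite mul1r.
by rewrite mul0r fine_ge0.
Qed.

(** * Powerlessness of procedures with small false discovery rate *)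

Lemma mixture_ub (R : realType) (n : nat) (d : measure_display)
    (T : measurableType d) (Q : {ffun 'I_n -> bool} -> probability T R)
    (p k c : R) (S : set T) : 0 <= p <= 1 -> 0 < k -> 0 <= c -> measurable S ->
  (forall Z, (ones Z)%:R <= k -> (Q Z S <= c%:E)%E) ->
  (\sum_Z (bit_weight (fun=> p) Z)%:E * Q Z S <= (c + n%:R * p / k)%:E)%E.
Proof.
move=> p01 k0 c0 mS QS.
have w0 (Z : {ffun 'I_n -> bool}) : 0 <= bit_weight (fun=> p) Z :> R.
  by apply: bit_weight_ge0.
have QE Z : Q Z S = (fine (Q Z S))%:E by rewrite fineK// fin_num_measure.
under eq_bigr do rewrite QE -EFinM.
rewrite sumEFin lee_fin.
have := @bit_weight_upper_tail R n (fun=> p) k (fun=> p01) k0.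
rewrite sumr_const card_ord -[p *+ n]mulr_natl => tail.
apply: le_trans (lerD (lexx c) tail).
have cE : c = \sum_(Z : {ffun 'I_n -> bool}) c * bit_weight (fun=> p) Z.
  by rewrite -mulr_sumr sum_bit_weight mulr1.
rewrite [X in _ <= X + _]cE.
rewrite [X in _ + X]big_mkcond -big_split/=; apply: ler_sum => Z _.
have /andP[f0 f1] := fine_probability_itv (Q Z) mS.
case: ltP => Zk.
  rewrite -[leLHS]add0r lerD ?mulr_ge0//.
  by rewrite -[leRHS]mulr1 ler_wpM2l.
by rewrite addr0 mulrC ler_wpM2r// -lee_fin -QE; exact: QS.
Qed.

Lemma majority_of_split (a b r : nat) :
  (a + b = r -> 2 * a < r -> r <= 2 * b)%N.
Proof. lia. Qed.

(** The two mixtures give the same probability to the event of rejecting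
something. That event is split according to the region containing half of the
rejections, and each part is bounded in the reading for which this region
contains only true nulls. Averaging over the configurations of the first
reading then leaves a good one. *)
Lemma exists_undetected (R : realType) (n : nat) (g1 g2 : probability R R)
    (U : set R) (s p q c k1 k2 : R) (rej : n.-tuple R -> {set 'I_n}) :
  0 < s -> 0 < p <= 1 -> 0 < q <= 1 ->
  (forall A : set R, measurable A ->
    ((1 - p)%:E * normal_law 0 1 A + p%:E * g1 A =
     (1 - q)%:E * normal_law 0 s A + q%:E * g2 A)%E) ->
  measurable U -> g1 (~` U) = 0%E -> g2 U = 0%E ->
  0 < k1 -> k1 <= k2 -> k2 < n%:R / 2 -> 0 <= c ->
  4 * c + n%:R * p / k1 + n%:R * q / k2 <
    3 / 5 * (1 - expR (- (n%:R * p / 4)) - n%:R * p / k1) ->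
  multiple_testing_procedure rej ->
  (forall P, calP P -> (n1 P)%:R <= k2 -> (FDR P rej <= c%:E)%E) ->
  exists Z : {ffun 'I_n -> bool},
    [/\ n%:R * p / 4 <= (ones Z)%:R, (ones Z)%:R <= k1 &
        (contaminated (normal_law 0 1) g1 Z [set y | (0 < #|rej y|)%N]
           <= (3 / 5)%:E)%E].
Proof.
move=> s0 p01 q01 mix mU g1U g2U k10 k12 k2n c0 num mrej FDRc.
have k20 : 0 < k2 by exact: lt_le_trans k10 k12.
have [p0 p1] : 0 < p /\ p <= 1 by apply/andP.
have [q0 q1] : 0 < q /\ q <= 1 by apply/andP.
have p01' : 0 <= p <= 1 by rewrite ltW.
have q01' : 0 <= q <= 1 by rewrite ltW.
have g10 : exists2 A : set R, measurable A & g1 A <> normal_prob 0 1 A.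
  apply: (@reading_differs R (normal_law 0 1) (normal_law 0 s) g1 g2 p q (~` U)) => //.
  - exact: measurableC.
  - by apply: mix; exact: measurableC.
  - by rewrite setCK.
have g20 : exists2 A : set R, measurable A & g2 A <> normal_prob 0 s A.
  by apply: (@reading_differs R (normal_law 0 s) (normal_law 0 1) g2 g1 q p U) => //;
    rewrite mix.
pose S V := majority_in rej V.
have mS (V : set R) : measurable V -> measurable (S V).
  exact: measurable_majority_in.
have mUC := measurableC mU.
have family (s' : R) (g : probability R R) (V : set R) Z k : 0 < s' -> k <= k2 ->
    measurable V -> g V = 0%E ->
    (exists2 A : set R, measurable A & g A <> normal_prob 0 s' A) ->
    (ones Z)%:R <= k ->
    (contaminated (normal_law 0 s') g Z (S V) <= (2 * c)%:E)%E.
  move=> s'0 kk2 mV gV gs Zk.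
  have Zn : (ones Z)%:R < n%:R / 2 :> R by rewrite (le_lt_trans Zk)// (le_lt_trans kk2).
  have [cP _ _ fP] := contaminated_model s'0 gs Zn.
  apply: FDR_majority_bound => //.
    by move=> i; rewrite fP inE => Zi; rewrite marginal_contaminated// Zi.
  by apply: FDRc => //; rewrite /n1 fP (le_trans Zk).
pose D := [set y | (0 < #|rej y|)%N].
have mD : measurable D by exact: (mrej [set A : {set 'I_n} | (0 < #|A|)%N]).
(* Rejections inside and outside [U] cannot both be a strict minority. *)
have DS : D `<=` S (~` U) `|` S U.
  move=> y Dy; have : (#|(rej y :&: [set i | `[< (~` U) (tnth y i) >]])%SET| +
      #|(rej y :&: [set i | `[< U (tnth y i) >]])%SET| = #|rej y|)%N.
    rewrite -[RHS](cardsID [set i | `[< (~` U) (tnth y i) >]]%SET); congr (_ + _)%N.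
    apply: eq_card => i; rewrite !inE andbC; congr (_ && _).
    by rewrite -[`[< U _ >]]negbK; congr (~~ _); rewrite -asbool_neg.
  move=> e; have [h|h] := leqP #|rej y|
      (2 * #|(rej y :&: [set i | `[< (~` U) (tnth y i) >]])%SET|); [by left|right].
  by split => //; exact: majority_of_split e h.
have w0 (r : R) (r01 : 0 <= r <= 1) (Z : {ffun 'I_n -> bool}) : 0 <= bit_weight (fun=> r) Z :> R.
  by apply: bit_weight_ge0.
have [M ME] := exists_combination (contaminated (n := n) (normal_law 0 1) g1)
  (w0 p p01').
have MD : (M D <= (4 * c + n%:R * p / k1 + n%:R * q / k2)%:E)%E.
  apply: (@le_trans _ _ (M (S (~` U)) + M (S U))%E).
    apply: le_trans (measureU2 M (mS _ mUC) (mS _ mU)).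
    by rewrite le_measure ?inE//; apply: measurableU; exact: mS.
  rewrite [leRHS](_ : _ = ((2 * c + n%:R * p / k1)%:E + (2 * c + n%:R * q / k2)%:E)%E).
    apply: leeD.
      rewrite ME; apply: mixture_ub => //; [by rewrite mulr_ge0|exact: mS|].
      by move=> Z; exact: family.
    rewrite ME (eq_mixture p01' q01' mix); last exact: mS.
    apply: mixture_ub => //; [by rewrite mulr_ge0|exact: mS|].
    by move=> Z; exact: family.
  by rewrite -EFinD; congr (_%:E); ring.
apply: contrapT => noZ; move: MD; apply/negP; rewrite -ltNge.
apply: (@lt_le_trans _ _ (3 / 5 * (1 - expR (- (n%:R * p / 4)) - n%:R * p / k1))%:E).
  by rewrite lte_fin.
have DE Z : contaminated (normal_law 0 1) g1 Z D =
    (fine (contaminated (normal_law 0 1) g1 Z D))%:E.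
  by rewrite fineK// fin_num_measure.
rewrite ME; under eq_bigr do rewrite DE -EFinM.
rewrite sumEFin lee_fin.
have up := @bit_weight_upper_tail R n (fun=> p) k1 (fun=> p01') k10.
have low := @bit_weight_lower_tail R n (fun=> p) (n%:R * p / 4) (fun=> p01').
have one := @sum_bit_weight R n (fun=> p).
rewrite sumr_const card_ord -[p *+ n]mulr_natl in up low.
rewrite (_ : n%:R * p / 4 - n%:R * p / 2 = - (n%:R * p / 4)) in low; last by field.
apply: (@le_trans _ _ (3 / 5 * (\sum_(Z : {ffun 'I_n -> bool}) bit_weight (fun=> p) Z
   - \sum_(Z : {ffun 'I_n -> bool} | (ones Z)%:R < n%:R * p / 4) bit_weight (fun=> p) Z
   - \sum_(Z : {ffun 'I_n -> bool} | k1 < (ones Z)%:R) bit_weight (fun=> p) Z))).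
  by rewrite ler_pM2l// one; lra.
rewrite [X in _ - X - _]big_mkcond [X in _ - _ - X]big_mkcond -!sumrB mulr_sumr.
apply: ler_sum => Z _; have wZ := w0 p p01' Z.
have /andP[d0 d1] := fine_probability_itv (contaminated (normal_law 0 1) g1 Z) mD.
have wd0 := mulr_ge0 wZ d0.
case: ltP => Zlow; case: ltP => Zup; try lra.
rewrite !subr0 mulrC ler_wpM2l//; apply/ltW; rewrite ltNge; apply/negP => h.
by apply: noZ; exists Z; split => //; rewrite [leLHS]DE lee_fin.
Qed.

(** * The lower bound *)

Definition tail_constant {R : realType} : R := normal_peak 1 * expR (- (3 / 2)).

Lemma tail_constant_gt0 (R : realType) : 0 < tail_constant :> R.
Proof. by rewrite mulr_gt0 ?expR_gt0// normal_peak_gt0 ?oner_neq0. Qed.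

Lemma expRN_le_inv (R : realType) (x : R) : 0 <= x -> expR (- x) <= (1 + x)^-1.
Proof.
move=> x0; rewrite expRN lef_pV2 ?posrE ?expR_gt0 ?expR_ge1Dx//.
by rewrite ltr_pwDl.
Qed.

Lemma half_le_ln (R : realType) (x : R) : 2 <= x -> 1 / 2 <= ln x.
Proof.
move=> x2; have x0 : 0 < x by rewrite (lt_le_trans _ x2).
rewrite -ler_expR lnK ?posrE//; apply: le_trans x2.
rewrite -[leRHS]invrK -[leLHS]invrK lef_pV2 ?posrE ?invr_gt0 ?expR_gt0//.
by rewrite -expRN; have := @expR_ge1Dx R (- (1 / 2)); lra.
Qed.

Lemma upper_tail_sqrt_ln (R : realType) (x : R) : expR 1 <= x ->
  tail_constant * Num.sqrt (x / ln x) <= x * upper_tail (Num.sqrt (ln x)).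
Proof.
move=> xe; have x0 : 0 < x by rewrite (lt_le_trans _ xe)// expR_gt0.
have l1 : 1 <= ln x by rewrite -ler_expR lnK.
have l0 : 0 < ln x by rewrite (lt_le_trans ltr01).
have s1 : 1 <= Num.sqrt (ln x) by rewrite -[leLHS]sqrtr1 ler_wsqrtr.
have := normal_upper_tail_lb s1; rewrite sqr_sqrtr ?(ltW l0)//.
rewrite -(fineK (fin_num_measure (normal_prob 0 1) _ (measurable_itv _))) lee_fin.
rewrite -/(upper_tail _) -/tail_constant => tl.
have := ler_wpM2l (ltW x0) tl; apply: le_trans.
rewrite mulrCA ler_pM2l ?tail_constant_gt0//.
have -> : expR (- (ln x / 2)) = (Num.sqrt x)^-1.
  rewrite expRN; congr (_^-1); apply/eqP.
  rewrite -(@eqrXn2 _ 2) ?expR_ge0// sqr_sqrtr ?(ltW x0)// -expRM_natl.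
  by rewrite [_ * (_ / 2)](_ : _ = ln x) ?lnK//; field.
rewrite sqrtrM ?(ltW x0)// sqrtrV ?(ltW l0)// mulrA.
rewrite ler_pM2r ?invr_gt0 ?(lt_le_trans ltr01)//.
by rewrite -{2}(sqr_sqrtr (ltW x0)) expr2 mulfK// gt_eqF// sqrtr_gt0.
Qed.

Lemma sqrt_over_ln_lb (R : realType) (kap x : R) : 0 < kap ->
  expR 1 + 4 * (kap ^-1) ^+ 4 <= x -> kap^-1 <= Num.sqrt (x / ln x).
Proof.
move=> k0 xge; have v0 : 0 < kap^-1 by rewrite invr_gt0.
have v4 : 0 < kap^-1 ^+ 4 by rewrite exprn_gt0.
have e0 := expR_gt0 (1 : R).
have x0 : 0 < x by lra.
have l1 : 1 <= ln x by rewrite -ler_expR lnK//; lra.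
have l0 : 0 < ln x by rewrite (lt_le_trans ltr01).
rewrite -[leLHS]ger0_norm ?(ltW v0)// -sqrtr_sqr ler_wsqrtr//.
rewrite ler_pdivlMr//.
have q0 : 0 < Num.sqrt x by rewrite sqrtr_gt0.
have qq : Num.sqrt x ^+ 2 = x by rewrite sqr_sqrtr ?ltW.
have lq : ln x <= 2 * Num.sqrt x.
  have -> : ln x = 2 * ln (Num.sqrt x) by rewrite -{1}qq lnXn// mulr_natl.
  rewrite ler_pM2l// ltW// -ltr_expR lnK//.
  by apply: lt_le_trans (expR_ge1Dx _); rewrite ltrDr.
have qv : 2 * kap^-1 ^+ 2 <= Num.sqrt x.
  rewrite -(@ler_pXn2r _ 2) ?nnegrE ?(ltW q0)//; last by rewrite mulr_ge0// exprn_ge0// ltW.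
  by rewrite exprMn -exprM qq; lra.
apply: (@le_trans _ _ (kap^-1 ^+ 2 * (2 * Num.sqrt x))).
  by rewrite ler_wpM2l// exprn_ge0// ltW.
by have := ler_wpM2r (ltW q0) qv; rewrite -expr2 qq; lra.
Qed.

Lemma probability_setI_ge (d : measure_display) (T : measurableType d)
    (R : realType) (P : probability T R) (A B : set T) (a b : R) :
  measurable A -> measurable B -> (a%:E <= P A)%E -> (b%:E <= P B)%E ->
  ((a + b - 1)%:E <= P (A `&` B))%E.
Proof.
move=> mA mB PA PB; have mC := measurableI _ _ mA mB.
have : (P (~` (A `&` B)) <= P (~` A) + P (~` B))%E.
  by rewrite setCI; apply: measureU2; exact: measurableC.
rewrite !probability_setC//.
move: PA PB; rewrite -(fineK (fin_num_measure P _ mA)) -(fineK (fin_num_measure P _ mB)).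
rewrite -(fineK (fin_num_measure P _ mC)) -!EFinB -EFinD !lee_fin; lra.
Qed.

(** The choice [t2 = 4 (1 + ln (k2 / k1))] makes [expR (- t2 / 4)] proportional to
[k1 / k2], so that the mass of the first contamination is of order [b k1 / k2];
the second contamination is of order [b t2], so [b] is taken proportional to
[k2 / (n t2)]. The hypothesis on [k1] and [k2] is then a lower bound on
[b ln n]. *)
Lemma exists_tilt_parameters (R : realType) (N alpha k1 k2 : R) :
  expR 1 <= N -> 0 < alpha < 1 -> 0 < k1 -> k1 <= k2 ->
  1600 * (N * ln (2 / alpha) / ln N) * (1 + ln (k2 / k1)) <= k2 ->
  k2 < N / 2 ->
  exists b t2 : R,
    [/\ 0 < b <= 1 / 4, 4 <= t2 /\ t2 < ln N,
        3 * b * expR (- (t2 / 4)) <= 3 * k1 / (160 * N),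
        b * t2 / 2 + 3 * b * expR (- (t2 / 4)) <= 7 * k2 / (160 * N) &
        128 / alpha <= expR (b * (ln N - t2) / 2) - 1].
Proof.
move=> Ne /andP[a0 a1] k10 k12 hk k2n.
have N0 : 0 < N by rewrite (lt_le_trans _ Ne)// expR_gt0.
have l1 : 1 <= ln N by rewrite -ler_expR lnK.
have l0 : 0 < ln N by rewrite (lt_le_trans ltr01).
have k20 : 0 < k2 by exact: lt_le_trans k10 k12.
set l := ln (2 / alpha) in hk.
have l2 : 1 / 2 <= l by rewrite half_le_ln// ler_pdivlMr//; lra.
set L := ln (k2 / k1) in hk.
have L0 : 0 <= L by rewrite ln_ge0// ler_pdivlMr// mul1r.
pose b := k2 / (80 * N * (1 + L)).
pose t2 := 4 * (1 + L).
have L1 : 0 < 1 + L by lra.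
have bN : b * (80 * N * (1 + L)) = k2.
  by rewrite /b divfK// gt_eqF// !mulr_gt0.
have b0 : 0 < b by rewrite divr_gt0// !mulr_gt0.
have bt2 : b * t2 = k2 / (20 * N).
  by rewrite /t2 -bN; field; rewrite gt_eqF.
have bl : 20 * l <= b * ln N.
  rewrite -(@ler_pM2r _ (80 * N * (1 + L))) ?mulr_gt0//.
  rewrite [leRHS]mulrAC bN -ler_pdivrMr//; apply: le_trans hk.
  by rewrite le_eqVlt; apply/orP; left; apply/eqP; field; rewrite gt_eqF.
have bt2' : b * t2 <= 1 / 40.
  by rewrite bt2 ler_pdivrMr ?mulr_gt0//; lra.
have b4 : b <= 1 / 4.
  have : b * 4 <= b * t2 by rewrite ler_pM2l// /t2; lra.
  lra.
have tx : t2 < ln N by rewrite -(ltr_pM2l b0); lra.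
have et2 : expR (- (t2 / 4)) <= k1 / k2 / 2.
  rewrite (_ : - (t2 / 4) = - 1 + ln (k1 / k2)); last first.
    rewrite -[k1 / k2]invrK lnV ?posrE ?invr_gt0 ?divr_gt0// invf_div.
    by rewrite /t2 -/L; field.
  rewrite expRD lnK ?posrE ?divr_gt0// mulrC ler_pM2l ?divr_gt0//.
  by have := expRN1_le_half R; lra.
have bk : b <= k2 / (80 * N).
  have bN' : b * (80 * N) * (1 + L) = k2 by rewrite -[RHS]bN; ring.
  rewrite ler_pdivlMr ?mulr_gt0// -[leRHS]bN'.
  by apply: ler_peMr; [apply/ltW/mulr_gt0 => //; exact: mulr_gt0|lra].
have excess1 : 3 * b * expR (- (t2 / 4)) <= 3 * k1 / (160 * N).
  apply: (@le_trans _ _ (3 * (k2 / (80 * N)) * (k1 / k2 / 2))).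
    by apply: ler_pM => //; [rewrite mulr_ge0// ltW | rewrite ler_pM2l].
  by rewrite le_eqVlt; apply/orP; left; apply/eqP; field; rewrite !gt_eqF.
have K64 : 128 / alpha <= expR (b * (ln N - t2) / 2) - 1.
  have a2 : 2 <= 2 / alpha by rewrite ler_pdivlMr//; lra.
  have -> : 128 / alpha = 64 * (2 / alpha) by field; rewrite gt_eqF.
  have : expR (9 * l) <= expR (b * (ln N - t2) / 2).
    by rewrite ler_expR mulrBr; lra.
  have -> : expR (9 * l) = (2 / alpha) ^+ 9.
    by rewrite expRM_natl lnK// posrE; lra.
  set z := 2 / alpha in a2 *.
  have : 2 ^+ 8 * z <= z ^+ 9.
    rewrite [z ^+ 9]exprSr ler_wpM2r//; first by lra.
    by rewrite ler_pXn2r ?nnegrE//; lra.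
  by lra.
exists b, t2; split.
- by rewrite b0.
- by split; [rewrite /t2; lra|].
- exact: excess1.
- apply: (@le_trans _ _ (k2 / (20 * N) / 2 + 3 * k2 / (160 * N))).
    rewrite bt2 lerD2l; apply: (le_trans excess1).
    by rewrite ler_pM2r ?invr_gt0 ?mulr_gt0// ler_pM2l.
  by rewrite le_eqVlt; apply/orP; left; apply/eqP; field; rewrite gt_eqF.
- exact: K64.
Qed.

Lemma exists_hard_distribution (R : realType) (n : nat) (alpha k1 k2 : R)
    (rej : n.-tuple R -> {set 'I_n}) :
  expR 1 + 4 * (tail_constant^-1) ^+ 4 <= n%:R :> R ->
  0 < alpha < 1 -> 0 < k1 -> k1 <= k2 ->
  1600 * (n%:R * ln (2 / alpha) / ln n%:R) * (1 + ln (k2 / k1)) <= k2 ->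
  k2 < n%:R / 2 -> multiple_testing_procedure rej ->
  (forall P, calP P -> (n1 P)%:R <= k2 -> (FDR P rej <= (1 / 40)%:E)%E) ->
  let r := alpha^-1 * Num.sqrt (n%:R / ln n%:R) in
  exists P : probability (n.-tuple R) R,
    [/\ calP P /\ (n1 P)%:R <= k1,
        ((2 / 5)%:E <= P [set y | #|(rej y :&: false_nulls P)%SET| = 0%N])%E,
        ((1 - expR (- (4 * tail_constant * r)))%:E <=
          P [set y | (4 * tail_constant * r <=
                      #|(oracle_BH P (alpha / 2) y :&: false_nulls P)%SET|%:R)%R])%E &
        4 / 5 <= 1 - expR (- (4 * tail_constant * r))].
Proof.
move=> nc a01 k10 k12 hk k2n mrej FDRc r.
have /andP[a0 a1] := a01.
have a2 : 0 < alpha / 2 <= 1 by apply/andP; split; lra.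
set N : R := n%:R in nc hk k2n r *.
have kap0 := tail_constant_gt0 R; set kap := tail_constant in nc kap0 r *.
have v4 : 0 < kap^-1 ^+ 4 by rewrite exprn_gt0// invr_gt0.
have Ne : expR 1 <= N.
  by apply: le_trans nc; rewrite lerDl mulr_ge0// ltW.
have [b [t2 [b04 [t24 t2N] excess1 q2 K128]]] :=
  exists_tilt_parameters Ne a01 k10 k12 hk k2n.
have N0 : 0 < N by exact: lt_le_trans (expR_gt0 1) Ne.
have l0 : 0 < ln N by apply: lt_trans t2N; exact: lt_le_trans t24.
have k20 : 0 < k2 by exact: lt_le_trans k10 k12.
have r1 : kap^-1 <= r.
  apply: (le_trans (sqrt_over_ln_lb kap0 nc)); rewrite ler_peMl ?sqrtr_ge0//.
  by rewrite invf_ge1// ltW.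
have cr4 : 4 <= 4 * kap * r.
  by rewrite -mulrA ler_peMr// mulrC -ler_pdivrMr// mul1r.
have tail45 : 4 / 5 <= 1 - expR (- (4 * kap * r)).
  have : expR (- (4 * kap * r)) <= expR (- 4) by rewrite ler_expR lerN2.
  have := @expRN_le_inv R 4 _; rewrite (_ : (1 + 4)^-1 = 1 / 5 :> R); last by field.
  by move=> /(_ (ler0n _ _)); lra.
pose x0 := Num.sqrt (ln N).
have x00 : 0 <= x0 by exact: sqrtr_ge0.
have x02 : x0 ^+ 2 = ln N by rewrite sqr_sqrtr ?ltW.
rewrite -x02 in t2N K128.
have [s [p [q [g1 [g2 [U [[s0 p01 q01] [pub qub] mix [mU g1U g2U] pG]]]]]]] :=
  exists_normal_readings b04 t24 x00 t2N.
have [p0 p1] : 0 < p /\ p <= 1 by apply/andP.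
(* Both contaminations have an expected size well below the sparsity bounds. *)
have npk1 : N * p / k1 <= 3 / 160.
  rewrite ler_pdivrMr// mulrC -ler_pdivlMr//; apply: (le_trans pub).
  apply: (le_trans excess1); rewrite le_eqVlt; apply/orP; left; apply/eqP.
  by field; rewrite gt_eqF.
have nqk2 : N * q / k2 <= 7 / 160.
  rewrite ler_pdivrMr// mulrC -ler_pdivlMr//; apply: (le_trans qub).
  by apply: (le_trans q2); rewrite le_eqVlt; apply/orP; left; apply/eqP; field; rewrite gt_eqF.
(* At level [2 q0], Benjamini-Hochberg with parameter [alpha / 2] requires
   [n (2 q0) / (alpha / 2)] p-values. *)
pose q0 := upper_tail x0.
pose S := 4 * N * q0 / alpha.
have q0E : (normal_prob 0 1 `]x0, +oo[ = q0%:E)%E.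
  by rewrite fineK// fin_num_measure.
have Sr : 4 * kap * r <= S.
  have := upper_tail_sqrt_ln Ne; rewrite -/kap -/x0 -/q0 => h.
  have -> : S = 4 * alpha^-1 * (N * q0) by rewrite /S; ring.
  have -> : 4 * kap * r = 4 * alpha^-1 * (kap * Num.sqrt (N / ln N)).
    by rewrite /r; ring.
  by rewrite ler_pM2l// mulr_gt0 ?invr_gt0.
have NpG : 16 * S <= N * (p * fine (g1 [set` `]x0, +oo[])).
  move: pG; rewrite q0E -(fineK (fin_num_measure g1 _ (measurable_itv _))).
  rewrite -!EFinM lee_fin => pG.
  have q00 : 0 <= q0 by rewrite fine_ge0.
  have : 64 / alpha * q0 <= p * fine (g1 [set` `]x0, +oo[]).
    by apply: le_trans pG; rewrite ler_wpM2r//; lra.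
  move=> h; rewrite [leLHS](_ : _ = N * (64 / alpha * q0)).
    by rewrite ler_pM2l.
  by rewrite /S; ring.
have G01 := fine_probability_itv g1 (measurable_itv `]x0, +oo[).
set G := fine _ in NpG G01; have /andP[G0 G1] := G01.
have Np4 : 16 <= N * p / 4.
  have : N * (p * G) <= N * p by rewrite mulrA ler_piMr// mulr_ge0 ?ltW.
  lra.
have [||Z [Zlow Zup ZP]] := exists_undetected s0 p01 q01 mix mU g1U g2U k10 k12 k2n
  (_ : 0 <= 1 / 40) _ mrej FDRc.
- by [].
- have : expR (- (N * p / 4)) <= expR (- 16) by rewrite ler_expR lerN2.
  have := @expRN_le_inv R 16 _; rewrite (_ : (1 + 16)^-1 = 1 / 17 :> R); last by field.
  by move=> /(_ (ler0n _ _)); rewrite -/N; lra.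
have g10 : exists2 A : set R, measurable A & g1 A <> normal_prob 0 1 A.
  apply: (@reading_differs R (normal_law 0 1) (normal_law 0 s) g1 g2 p q (~` U)) => //.
  - exact: measurableC.
  - by apply: mix; exact: measurableC.
  - by rewrite setCK.
have Zn : (ones Z)%:R < n%:R / 2 :> R.
  by apply: le_lt_trans Zup _; exact: le_lt_trans k12 k2n.
have [cP thP siP fP] := contaminated_model ltr01 g10 Zn.
exists (contaminated (normal_law 0 1) g1 Z); split => //.
- by split => //; rewrite /n1 fP.
- rewrite fP; set P := contaminated _ _ _ in ZP *.
  have mD : measurable [set y | (0 < #|rej y|)%N].
    exact: (mrej [set A : {set 'I_n} | (0 < #|A|)%N]).
  apply: (@le_trans _ _ (P (~` [set y | (0 < #|rej y|)%N]))).
    rewrite probability_setC//; move: ZP.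
    rewrite -(fineK (fin_num_measure P _ mD)) -EFinB !lee_fin; lra.
  rewrite le_measure ?inE//; first exact: measurableC.
    exact: (mrej [set A : {set 'I_n} | #|(A :&: [set i | Z i])%SET| = 0%N]).
  move=> y /= /negP; rewrite -leqNgt leqn0 => /eqP R0.
  by apply/eqP; rewrite -leqn0 -R0; apply/subset_leq_card/subsetIl.
- apply: le_trans (oracle_power (x0 := x0) (s := S) (a := alpha / 2) g10 Zn _ x00 _ Sr).
  + rewrite lee_fin lerD2l lerN2 ler_expR -/G.
    have : N * p / 4 * G <= (ones Z)%:R * G by rewrite ler_wpM2r.
    by lra.
  + exact: a2.
  + rewrite -/q0 -/N /S le_eqVlt; apply/orP; left; apply/eqP.
    by field; rewrite gt_eqF.
Qed.

(** Under the hard distribution, the procedure has no true discovery with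
probability at least [2 / 5] and the oracle has one with probability at least
[4 / 5]; the two events occur together with probability at least [1 / 5]. *)
Lemma property_L_holds (R : realType) :
  @property_L R (expR 1 + 4 * (tail_constant^-1) ^+ 4) 1600 (1 / 40)
    (4 * tail_constant) (4 * tail_constant).
Proof.
move=> n nc alpha a0 a1 k1 k2 k10 k12 hk k2n rej mrej r.
have a01 : 0 < alpha < 1 by rewrite a0.
have hard FDRc := exists_hard_distribution nc a01 k10 k12 hk k2n mrej FDRc.
split; first exact: hard.
move=> I2; have [|P [[cP Pk1] P25 P45 e45]] := hard.
  move=> P cP Pk2; apply: le_trans I2; apply: ereal_sup_ubound.
  by exists P.
apply: (@le_trans _ _ (P [set y | TDP P (rej y) < TDP P (oracle_BH P (alpha / 2) y)])); last first.
  by apply: ereal_sup_ubound; exists P.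
set E := (X in P X).
have mBH := @multiple_testing_procedure_BH R n (alpha / 2) (theta P) (sigma P)
  (divr_gt0 a0 (ltr0Sn _ _)).
have mE : measurable E.
  pose F (A : {set 'I_n}) := [set y : n.-tuple R |
    TDP P A < TDP P (oracle_BH P (alpha / 2) y)].
  apply: (measurable_rejections (E := F) mrej) => A.
  exact: (mBH [set B | TDP P A < TDP P B]).
set A := (X in P X) in P25; set B := (X in P X) in P45.
have mA : measurable A.
  exact: (mrej [set D : {set 'I_n} | #|(D :&: false_nulls P)%SET| = 0%N]).
have mB : measurable B.
  exact: (mBH [set D | 4 * tail_constant * r <= #|(D :&: false_nulls P)%SET|%:R]).
have P45' : ((4 / 5)%:E <= P B)%E by apply: le_trans P45; rewrite lee_fin.
have := probability_setI_ge mA mB P25 P45'.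
rewrite (_ : 2 / 5 + 4 / 5 - 1 = 1 / 5); last by field.
move=> /le_trans; apply; rewrite le_measure ?inE//; first exact: measurableI.
move=> y [/= Ay By]; rewrite /E/= /TDP Ay mul0r divr_gt0//.
  apply: lt_le_trans By; apply: mulr_gt0.
    by apply: mulr_gt0 => //; exact: tail_constant_gt0.
  apply: mulr_gt0; first by rewrite invr_gt0.
  have e0 := expR_gt0 (1 : R).
  have v4 : 0 < (@tail_constant R)^-1 ^+ 4 by rewrite exprn_gt0// invr_gt0 tail_constant_gt0.
  rewrite sqrtr_gt0 divr_gt0//; first lra.
  by rewrite (lt_le_trans ltr01)// -ler_expR lnK ?posrE; lra.
Qed.

(** Taking logarithms, [1 + ln (k2 / k1) = ln (1 / eps) / (c ln (2 / alpha))], so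
the factor [ln (2 / alpha)] cancels; the upper bound on [eps] gives [k1 <= k2]
and the lower bound gives [k2 < N / 2]. *)
Lemma sparsity_trade_off (R : realType) (c alpha eps N : R) :
  0 < c -> 0 < alpha < 2 -> 1 < N ->
  N `^ (- (1 / 2)) < eps -> eps < (alpha / 2) `^ c ->
  let k2 := ln (1 / eps) * N / ln N in
  let k1 := eps `^ ((c * ln (2 / alpha))^-1) * ln (1 / eps) * expR 1 * N / ln N in
  [/\ 0 < k1, k1 <= k2,
      c * (N * ln (2 / alpha) / ln N) * (1 + ln (k2 / k1)) = k2 &
      k2 < N / 2].
Proof.
move=> c0 /andP[a0 a2] N1 epsN epsa k2 k1.
have N0 : 0 < N by rewrite (lt_trans ltr01).
have lN : 0 < ln N by rewrite ln_gt0.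
have eps0 : 0 < eps by rewrite (lt_trans _ epsN)// powR_gt0.
have l0 : 0 < ln (2 / alpha) by rewrite ln_gt0// ltr_pdivlMr// mul1r.
set l := ln (2 / alpha) in l0 k1 *.
have lna : ln (alpha / 2) = - l by rewrite -invf_div lnV// posrE divr_gt0.
have lneps : ln eps < - (c * l).
  by move: epsa; rewrite -ltr_ln ?posrE ?powR_gt0 ?divr_gt0// ln_powR lna mulrN.
have lnepsN : - (1 / 2) * ln N < ln eps.
  by move: epsN; rewrite -ltr_ln ?posrE ?powR_gt0// ln_powR.
have cl0 : 0 < c * l by rewrite mulr_gt0.
have lie : ln (1 / eps) = - ln eps by rewrite div1r lnV.
have w0 : 0 < ln (1 / eps) by rewrite lie; lra.
have k20 : 0 < k2 by rewrite /k2 divr_gt0// mulr_gt0.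
have k1E : k1 = k2 * expR (1 + ln eps / (c * l)).
  rewrite /k1 /k2 expRD /powR gt_eqF// [(c * l)^-1 * _]mulrC.
  by ring.
have lk : ln (k2 / k1) = - (1 + ln eps / (c * l)).
  rewrite k1E invfM mulrA divff ?gt_eqF// mul1r -expRN expRK.
  by [].
split.
- by rewrite k1E mulr_gt0// expR_gt0.
- rewrite k1E ler_piMr ?(ltW k20)// -[leRHS]expR0 ler_expR.
  have : ln eps / (c * l) <= - 1 by rewrite ler_pdivrMr//; lra.
  lra.
- rewrite lk /k2 lie; field.
  by rewrite !gt_eqF.
- rewrite /k2 ltr_pdivrMr// lie -subr_gt0.
  rewrite (_ : _ - _ = N * (ln eps - - (1 / 2) * ln N)); last by field.
  by rewrite mulr_gt0// subr_gt0.
Qed.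

Unset Implicit Arguments.

Theorem corollary3p3 (R : realType) :
  exists c1 c2 c3 c4 c5 : R,
    [/\ [/\ 0 < c1, 0 < c2, 0 < c3, 0 < c4 & 0 < c5],
        property_L c1 c2 c3 c4 c5 &
        forall (alpha : R), 0 < alpha -> alpha < c3 ->
        forall (n : nat), c1 <= n%:R ->
        (forall eps : R,
           n%:R `^ (- (1 / 2)) < eps -> eps < (alpha / 2) `^ c2 ->
           forall rej : n.-tuple R -> {set 'I_n},
           multiple_testing_procedure rej ->
           let k2 := ln (1 / eps) * n%:R / ln n%:R in
           let k1 := eps `^ ((c2 * ln (2 / alpha))^-1) * ln (1 / eps)
                     * expR 1 * n%:R / ln n%:R in
           (risk_I rej k2 <= c3%:E)%E ->
           (risk_II rej k1 (alpha / 2) >= (1 / 5)%:E)%E)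
        /\
        (n%:R `^ (- (1 / 4)) < (alpha / 2) `^ c2 ->
         let delta := 1 / (4 * c2 * ln (2 / alpha)) in
         let k := n%:R `^ (1 - delta) * expR 1 / 4 in
         0 < delta /\
         forall rej : n.-tuple R -> {set 'I_n},
           multiple_testing_procedure rej ->
           ((risk_I rej (n%:R / 4) <= alpha%:E)%E ->
            (risk_II rej k (alpha / 2) >= (1 / 5)%:E)%E)
           /\
           ((risk_II rej k (alpha / 2) < (1 / 5)%:E)%E ->
            (risk_I rej (n%:R / 4) > c3%:E)%E))].
Proof.
have kap0 := tail_constant_gt0 R.
have e0 := expR_gt0 (1 : R).
have v4 : 0 < (@tail_constant R)^-1 ^+ 4 by rewrite exprn_gt0// invr_gt0.
have [c2 c20 L] : exists2 c2 : R, 0 < c2 &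
    property_L (expR 1 + 4 * (tail_constant^-1) ^+ 4) c2 (1 / 40)
      (4 * tail_constant) (4 * tail_constant).
  by exists 1600; [rewrite ltr0n | exact: property_L_holds].
have c40 : 0 < 4 * tail_constant :> R by exact: mulr_gt0.
exists (expR 1 + 4 * (tail_constant^-1) ^+ 4), c2, (1 / 40),
  (4 * tail_constant), (4 * tail_constant).
split; [|exact: L|].
  by split => //; apply: addr_gt0 => //; exact: mulr_gt0.
move=> alpha a0 ac n nc; set N : R := n%:R.
have a1 : alpha < 1 by lra.
have a02 : 0 < alpha < 2 by lra.
have N1 : 1 < N.
  by apply: lt_le_trans nc; have := @expR_ge1Dx R 1; lra.
have main eps : N `^ (- (1 / 2)) < eps -> eps < (alpha / 2) `^ c2 ->
    forall rej : n.-tuple R -> {set 'I_n}, multiple_testing_procedure rej ->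
    (risk_I rej (ln (1 / eps) * N / ln N) <= (1 / 40)%:E)%E ->
    ((1 / 5)%:E <= risk_II rej (eps `^ ((c2 * ln (2 / alpha))^-1) * ln (1 / eps)
                     * expR 1 * N / ln N) (alpha / 2))%E.
  move=> epsN epsa rej mrej I2.
  have [k10 k12 hk k2n] := sparsity_trade_off c20 a02 N1 epsN epsa.
  have [] := L n nc alpha a0 a1 _ _ k10 k12 _ k2n rej mrej.
    by rewrite hk.
  by move=> _; apply.
split; first exact: main.
move=> N4 delta k.
have N0 : 0 < N by lra.
have lN : 0 < ln N by rewrite ln_gt0.
have l0 : 0 < ln (2 / alpha) by rewrite ln_gt0// ltr_pdivlMr//; lra.
have d0 : 0 < delta by rewrite divr_gt0// !mulr_gt0.
split => // rej mrej.
have imp : (risk_I rej (N / 4) <= (1 / 40)%:E)%E ->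
    ((1 / 5)%:E <= risk_II rej k (alpha / 2))%E.
  pose eps := N `^ (- (1 / 4)).
  have lneps : ln (1 / eps) = ln N / 4.
    by rewrite div1r lnV ?posrE ?powR_gt0// ln_powR; field.
  have := main eps _ N4 rej mrej.
  rewrite lneps (_ : ln N / 4 * N / ln N = N / 4); last by field; rewrite gt_eqF.
  have kE : N `^ (1 - delta) = N * eps `^ ((c2 * ln (2 / alpha))^-1).
    rewrite {1}/powR gt_eqF// mulrBl mul1r expRD lnK ?posrE//; congr (_ * _).
    rewrite /powR gt_eqF ?powR_gt0// ln_powR; congr expR.
    by rewrite /delta; field; rewrite !gt_eqF.
  rewrite (_ : _ * expR 1 * N / ln N = k).
    by apply; rewrite -ltr_ln ?posrE ?powR_gt0// !ln_powR ltr_pM2r//; lra.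
  by rewrite /k kE; field; rewrite gt_eqF.
split.
- by move=> I2; apply: imp; apply: (le_trans I2); rewrite lee_fin ltW.
- by move=> II; rewrite ltNge; apply/negP => /imp; rewrite leNgt II.
Qed.
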